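(* Let $\mathcal{A}$ be a hyperplane arrangement in $\mathbb{R}^n$, and let $K$ be an apartment of $\mathcal{A}$. Then, in the polynomial ring $R_{\mathcal{A}}$, $$\det\big(\mathrm{v}(D,C)\big)_{C,D \in C_{\mathcal{A}}^K} = \prod_{F \in F_{\mathcal{A}}^K \setminus C_{\mathcal{A}}^K} (1 - \mathrm{b}_F)^{\beta_F}.$$
   Context: A hyperplane arrangement $\mathcal{A}$ in $\mathbb{R}^n$ is a finite set of affine hyperplanes of $\mathbb{R}^n$. For each hyperplane $H$, let $H^+$ and $H^-$ be the two connected open half-spaces bounded by $H$ (with a fixed choice of labels), and $H^0 := H$. A face of $\mathcal{A}$ is a nonempty subset of $\mathbb{R}^n$ of the form $F = \bigcap_{H \in \mathcal{A}} H^{\epsilon_H(F)}$ with $\epsilon_H(F) \in \{+,0,-\}$. $F_{\mathcal{A}}$ is the set of faces. A chamber is a face $F$ with $\epsilon_H(F) \neq 0$ for all $H \in \mathcal{A}$; $C_{\mathcal{A}}$ is the set of chambers. An empty arrangement has the single chamber $\mathbb{R}^n$. An apartment of $\mathcal{A}$ is a chamber of some subset $\mathcal{K} \subseteq \mathcal{A}$ (regarded as a hyperplane arrangement). For an apartment $K$, $F_{\mathcal{A}}^K := \{F \in F_{\mathcal{A}} \mid F \subseteq K\}$ and $C_{\mathcal{A}}^K := C_{\mathcal{A}} \cap F_{\mathcal{A}}^K$. Let $h_H^{\varepsilon}$ ($H \in \mathcal{A}$, $\varepsilon \in \{+,-\}$) be independent variables and $R_{\mathcal{A}} := \mathbb{Z}[h_H^{\varepsilon}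 \mid \varepsilon \in \{+,-\}, H \in \mathcal{A}]$. For chambers $C,D \in C_{\mathcal{A}}$ let $\mathscr{H}(C,D) := \{H^{\epsilon_H(C)} \mid H \in \mathcal{A},\ \epsilon_H(C) = -\epsilon_H(D)\}$, and define $\mathrm{v}(C,C) = 1$ and $\mathrm{v}(C,D) = \prod_{H^{\varepsilon} \in \mathscr{H}(C,D)} h_H^{\varepsilon}$ if $C \neq D$. For $F \in F_{\mathcal{A}} \setminus C_{\mathcal{A}}$: $\mathcal{A}_F := \{H \in \mathcal{A} \mid F \subseteq H\}$; the weight of $F$ is $\mathrm{b}_F := \prod_{H \in \mathcal{A}_F} h_H^+ h_H^-$; and the multiplicity of $F$ is the integer $$\beta_F := \frac{\#\{C \in C_{\mathcal{A}} \mid \overline{C} \cap H = \overline{F}\}}{2},$$ where $H$ is any chosen hyperplane in $\mathcal{A}_F$ (the value is independent of the choice of $H$). Here $\overline{S}$ denotes the topological closure of $S \subseteq \mathbb{R}^n$. *)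

(* Defs.v *)
From HB Require Import structures.
From mathcomp Require Import all_boot all_order all_algebra finmap.
From mathcomp Require Import all_classical all_reals topology normedtype.
(* The notations of mpoly clash with those of MathComp-Analysis. *)
From mathcomp Require Import -(notations) mpoly.

Set Implicit Arguments.
Unset Strict Implicit.
Unset Printing Implicit Defensive.

Import GRing.Theory Num.Theory numFieldNormedType.Exports.

Local Open Scope ring_scope.
Local Open Scope classical_set_scope.

Section Hyperplanes.
Variables (R : realType) (n : nat).
Implicit Types (a x : 'rV[R]_n) (c : R) (H : set 'rV[R]_n).

Definition dotp a x : R := \sum_i a 0 i * x 0 i.

Definition is_hyperplane H : Prop :=
  exists a c, a != 0 /\ H = [set x | dotp a x = c].

Definition is_arrangement (A : {fset set 'rV[R]_n}) : Prop :=
  forall H, H \in A -> is_hyperplane H.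

(* [hs H true] and [hs H false] are H^+ and H^-.  Replacing (a, c) by
   (-a, -c) exchanges them, so both labellings of each hyperplane occur. *)
Definition is_labelling (hs : set 'rV[R]_n -> bool -> set 'rV[R]_n) : Prop :=
  forall H, is_hyperplane H -> exists a c,
    [/\ a != 0,
        H = [set x | dotp a x = c],
        hs H true = [set x | c < dotp a x]
      & hs H false = [set x | dotp a x < c]].

End Hyperplanes.

(* The signs +, -, 0 are [Some true], [Some false], [None]. *)
Definition sign := option bool.
Definition sopp : sign -> sign := omap negb.

Section Faces.
Variables (R : realType) (n : nat).
Variable hs : set 'rV[R]_n -> bool -> set 'rV[R]_n.
Implicit Types (A : {fset set 'rV[R]_n}) (H F C D K : set 'rV[R]_n).

Definition region H (s : sign) : set 'rV[R]_n :=
  if s is Some b then hs H b else H.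

Definition cell A (e : {ffun A -> sign}) : set 'rV[R]_n :=
  [set x | forall H : A, region (val H) (e H) x].

Definition faces A : {fset set 'rV[R]_n} :=
  [fset cell e | e in [pred e : {ffun A -> sign} | `[< cell e !=set0 >]]]%fset.

(* The sign s such that F lies in H^s; it is unique when F is a face of an
   arrangement containing H, since H^+, H^0, H^- are disjoint and F is
   nonempty. *)
Definition eps H F : sign :=
  odflt None [pick s : sign | `[< F `<=` region H s >]].

Definition chambers A : {fset set 'rV[R]_n} :=
  [fset F in faces A | [forall H : A, eps (val H) F != None]]%fset.

Definition is_apartment A K : Prop :=
  exists2 B : {fset set 'rV[R]_n}, (B `<=` A)%fset & K \in chambers B.

Definition faces_in A K : {fset set 'rV[R]_n} :=
  [fset F in faces A | `[< (F `<=` K)%classic >]]%fset.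

Definition chambers_in A K : {fset set 'rV[R]_n} :=
  (chambers A `&` faces_in A K)%fset.

Definition polyring A : comNzRingType := mpoly #|{: A * bool}| int.

Definition hvar A (H : A) (b : bool) : polyring A :=
  mpolyX int (mnm1 (enum_rank (H, b))).

(* The half-space H^b is represented by the pair (H, b). *)
Definition sep A C D : {set A * bool} :=
  [set p | (eps (val p.1) C == sopp (eps (val p.1) D))
           && (eps (val p.1) C == Some p.2)]%SET.

Definition v A C D : polyring A :=
  if C == D then 1 else \prod_(p in sep A C D) hvar p.1 p.2.

Definition localization A F : {fset set 'rV[R]_n} :=
  [fset H in A | `[< (F `<=` H)%classic >]]%fset.

Definition weight A F : polyring A :=
  \prod_(H : A | val H \in localization A F) (hvar H true * hvar H false).

Definition mult A H F : nat :=
  (#|` [fset C in chambers A | `[< (closure C `&` H = closure F)%classic >]]%fset| %/ 2)%N.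

Definition vmatrix A K : 'M[polyring A]_#|{: chambers_in A K}| :=
  \matrix_(i, j) v A (val (enum_val j)) (val (enum_val i)).

End Faces.

(* Main.v *)
Require Import Defs.
From HB Require Import structures.
From mathcomp Require Import fingroup perm.
From mathcomp Require Import all_boot all_order all_algebra finmap.
From mathcomp Require Import all_classical all_reals topology normedtype.
From mathcomp Require Import -(notations) mpoly.
From mathcomp Require Import ring lra zify.
Import numFieldNormedType.Exports.
Local Open Scope ring_scope.

Set Implicit Arguments.
Unset Strict Implicit.
Unset Printing Implicit Defensive.

Import Order.TTheory GRing.Theory Num.Theory.

(** Record every face by its sign vector: one sign for each hyperplane.  An
    apartment K is then given by a partial sign vector k, and an induction on
    the number of hyperplanes on which k imposes nothing cuts K by such a
    hyperplane H into two smaller apartments K+ and K-.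

    The heart of the matter is the factorization [cone_mx_split]: the matrix of
    K is diag(V(K+), V(K-)) times a matrix N with unit diagonal whose other
    nonzero entries join chambers on opposite sides of H.  Its entries come from
    the identity [sum_crossing].  For C and D on opposite sides of H, dist C D
    is an alternating sum, over the faces F of H inside K, of
    dist C C' * dist C' D, where C' is D reflected through F; that chamber is on
    the side of C, so the right-hand factors can be read as entries of N.  A
    detour through C' multiplies the distance by h+ h- for every hyperplane
    having C and D on one side and C' on the other, so after expanding the
    products the identity is about alternating numbers of faces in convex
    regions.  These are controlled by a single Euler relation: the faces
    contained in a nonempty relatively open convex region, counted with the sign
    of their codimension, add up to the sign of the codimension of the region.
    By inclusion-exclusion, the part of such a region cut out by closed
    half-spaces missing a common point of the region then counts for zero
    ([weighted_euler_sum]).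

    The matrix N is triangular up to blocks of size 2.  The hinge of a chamber C
    is the greatest face of C lying in H; geometrically, its closure is the
    intersection of H with the closure of C.  By [crossing_hinge], a nonzero
    entry of N at (C, D) forces the hinge of C to lie on fewer hyperplanes than
    the hinge of D, unless C and D have a common hinge F and are exchanged by
    the reflection through F.  Such a pair gives a block with diagonal 1 and
    off-diagonal product b_F, whence det N is the product of the 1 - b_F over
    the chambers C on one side of H having a hinge F in K ([det_crossing_mx]).
    Reflection through F exchanges the two sides of H, so exactly half of the
    chambers with hinge F are on that side: the exponent of 1 - b_F is the
    multiplicity of F computed with H.

    The multiplicity does not depend on H.  Apply the formula to the apartment
    made of the faces containing F in their closure, once for each of two
    hyperplanes through F: all factors but that of F agree, the determinant is
    not zero, and the powers of 1 - b_F are distinct.  This argument only needs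
    the formula for apartments with fewer free hyperplanes, so it takes place
    inside the induction ([det_cone_mx]).

    All this uses three properties of the set of sign vectors
    ([euler_covectors]): reflections through faces exist, a segment crossing a
    hyperplane meets it, and the Euler relation holds.  They are proved for the
    sign vectors of points of a real affine arrangement
    ([affine_euler_covectors]), with the codimension of a flat computed as the
    rank of its normal vectors.  What remains is the dictionary between sign
    vectors and subsets of R^n, where closures become the face order
    ([closure_cell]). *)

(** * Determinants of matrices triangular for a preorder *)
Section Determinants.
Variables (Rg : comNzRingType) (N : nat).
Implicit Types (M : 'M[Rg]_N).

(** In the Leibniz formula only the identity survives: a permutation that never
    decreases o preserves its sum over the indices, so it fixes every index. *)
Lemma det_order_trig M (o : 'I_N -> nat) :
  (forall i j, i != j -> M i j != 0 -> (o i < o j)%N) ->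
  \det M = \prod_i M i i.
Proof.
move=> trigM; rewrite /determinant (bigD1 (1%g : {perm 'I_N})) //=.
rewrite odd_perm1 expr0 mul1r.
rewrite [X in _ + X]big1 ?addr0; first by apply: eq_bigr => i _; rewrite perm1.
move=> s s_neq1; have [i Mi0|all_nz] := pickP [pred i | M i (s i) == 0].
  by rewrite (bigD1 i) //= (eqP Mi0) mul0r mulr0.
case/eqP: s_neq1; apply/perm.permP => i; rewrite perm1; apply/eqP.
have leo j : (o j <= o (s j))%N.
  have [->//|sj] := eqVneq (s j) j.
  by apply/ltnW/trigM; [rewrite eq_sym | rewrite (negbT (all_nz j))].
have eqo : (\sum_j o j = \sum_j o (s j))%N by rewrite (reindex_inj (@perm_inj _ s)).
apply: contraT => si; have: (\sum_j o j < \sum_j o (s j))%N.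
  rewrite (bigD1 i) //= [ltnRHS](bigD1 i) //=.
  rewrite -addSn leq_add ?leq_sum //.
  by apply: trigM; [rewrite eq_sym | rewrite (negbT (all_nz i))].
by rewrite -eqo ltnn.
Qed.

(** A matrix with unit diagonal, triangular for the rank r except for entries
    joining i to its partner s i of the same rank; pos chooses one element in
    each pair, and every pair contributes a determinant of size 2. *)
Lemma det_order_matched M (r : 'I_N -> nat) (pos : pred 'I_N)
    (s : 'I_N -> 'I_N) :
  involutive s -> (forall i, r (s i) = r i) ->
  (forall i, s i != i -> pos (s i) = ~~ pos i) ->
  (forall i, M i i = 1) ->
  (forall i j, i != j -> M i j != 0 -> (r i < r j)%N \/ j = s i) ->
  \det M = \prod_(i | ~~ pos i && (s i != i)) (1 - M i (s i) * M (s i) i).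
Proof.
move=> sK rs poss M1 Mtrig.
(* B holds one of the two off-diagonal entries of each block; multiplication
   by 1 - B clears it, which makes M triangular. *)
pose B : 'M[Rg]_N :=
  \matrix_(i, j) (if [&& pos i, s i != i & j == s i] then M i j else 0).
have detB : \det (1%:M - B) = 1.
  rewrite (@det_order_trig _ (fun i => ~~ pos i : nat)).
    apply: big1 => i _; rewrite !mxE eqxx [i == s i]eq_sym andNb andbF.
    by rewrite subr0.
  move=> i j ij; rewrite !mxE (negPf ij) sub0r oppr_eq0.
  case: ifP => [/and3P[pi si /eqP->] _|]; last by rewrite eqxx.
  by rewrite poss // pi.
have MBE i k : (M *m (1%:M - B)) i k =
    M i k - (if ~~ pos k && (s k != k) then M i (s k) * M (s k) k else 0).
  rewrite mulmxBr mulmx1 !mxE; congr (_ - _).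
  case: ifP => [/andP[pk sk]|pk].
    rewrite (bigD1 (s k)) //= [X in _ + X]big1 ?addr0.
      by rewrite !mxE poss // pk sK eq_sym sk eqxx.
    move=> j jk; rewrite !mxE; case: ifP; last by rewrite mulr0.
    by case/and3P=> _ _ /eqP kE; rewrite kE sK eqxx in jk.
  apply: big1 => j _; rewrite !mxE; case: ifP; last by rewrite mulr0.
  case/and3P=> pj sj /eqP kE; move: pk.
  by rewrite kE sK poss // pj eq_sym sj.
have -> : \det M = \det (M *m (1%:M - B)) by rewrite det_mulmx detB mulr1.
(* The order is lexicographic: first r, then pos to separate partners. *)
rewrite (@det_order_trig _ (fun i => (r i).*2 + pos i)%N).
  rewrite [RHS]big_mkcond; apply: eq_bigr => i _; rewrite MBE M1.
  by case: ifP; rewrite ?subr0.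
move=> i k ik; rewrite MBE => nz.
have [rlt|rge] := ltnP (r i) (r k); first by case: (pos i) (pos k) => [] []; lia.
have kE : k = s i \/ ~~ pos k && (s k != k) /\ M i (s k) != 0 /\ s k != i.
  have [Mik|Mik] := eqVneq (M i k) 0; last first.
    by case: (Mtrig _ _ ik Mik) => [|]; [rewrite ltnNge rge | left].
  move: nz; rewrite Mik sub0r oppr_eq0; case: ifP => [pk nz|_]; last by rewrite eqxx.
  have [<-|ski] := eqVneq (s k) i; first by left; rewrite sK.
  right; split=> //; split=> //; apply: contraNneq nz => ->.
  by rewrite mul0r.
case: kE => [kE|[pk [Misk ski]]]; last first.
  have isk : i != s k by rewrite eq_sym.
  case: (Mtrig _ _ isk Misk) => [|/(can_inj sK) ki].
    by rewrite rs ltnNge rge.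
  by rewrite ki eqxx in ik.
have sii : s i != i by rewrite -kE eq_sym.
move: nz; rewrite kE rs sK poss // negbK [i == s i]eq_sym sii.
by case: (pos i); rewrite /= ?M1 ?mul1r ?subrr ?eqxx // addn0 addn1.
Qed.

End Determinants.

(** * Sign vectors and the Euler relation *)
Section Covectors.
Variables (E : finType).
Local Notation covector := {ffun E -> sign}.
Implicit Types (X Y F C D k : covector) (e f g H : E) (Z S : {set E}).

Definition zeros X : {set E} := [set e | X e == None]%SET.

Definition tope X := [forall e, X e != None].

(** The order of sign vectors in which None is below both signs.  Besides saying
    that X is a face of Y, it encodes apartments: Y lies in the apartment of the
    partial sign vector X when face_le X Y. *)
Definition face_le X Y := [forall e, (X e != None) ==> (X e == Y e)].

(** The composition of X with the opposite of Y.  If x and y are points with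
    these sign vectors, it is the sign vector reached from x by a small step
    away from y. *)
Definition reflect_in X Y : covector :=
  [ffun e => if X e is Some b then Some b else sopp (Y e)].

Definition constrain k g s : covector := [ffun e => if e == g then s else k e].

Lemma soppK : involutive sopp.
Proof. by case=> [[]|]. Qed.

Lemma zerosP X e : reflect (X e = None) (e \in zeros X).
Proof. by rewrite inE; apply: eqP. Qed.

Lemma topeP X : reflect (forall e, X e <> None) (tope X).
Proof. by apply: (iffP forallP) => tX e; apply/eqP/tX. Qed.

Lemma face_leP X Y : reflect (forall e, X e <> None -> X e = Y e) (face_le X Y).
Proof.
apply: (iffP forallP) => [le_XY e /eqP Xe|le_XY e].
  by have /implyP/(_ Xe)/eqP := le_XY e.
by apply/implyP => /eqP/le_XY->.
Qed.

Lemma face_le_refl X : face_le X X.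
Proof. exact/face_leP. Qed.

Lemma face_le_trans Y X F : face_le X Y -> face_le Y F -> face_le X F.
Proof.
move=> /face_leP XY /face_leP YZ; apply/face_leP => e Xe.
by rewrite (XY e Xe) YZ // -XY.
Qed.

Lemma face_le_anti X Y : face_le X Y -> face_le Y X -> X = Y.
Proof.
move=> /face_leP XY /face_leP YX; apply/ffunP => e.
have [Xe|/eqP/XY//] := eqVneq (X e) None.
by have [->//|/eqP/YX] := eqVneq (Y e) None.
Qed.

Lemma face_le_zeros X Y : face_le X Y -> zeros Y \subset zeros X.
Proof.
move=> /face_leP XY; apply/fintype.subsetP => e /zerosP Ye; apply/zerosP.
by have [//|/eqP/XY->] := eqVneq (X e) None.
Qed.

Lemma face_le_eq X Y : face_le X Y -> zeros X \subset zeros Y -> X = Y.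
Proof.
move=> /face_leP XY /fintype.subsetP sXY; apply/ffunP => e.
have [Xe|/eqP/XY//] := eqVneq (X e) None.
by have /zerosP-> : e \in zeros Y by apply/sXY/zerosP.
Qed.

Lemma tope_face_le_eq X Y : tope X -> face_le X Y -> X = Y.
Proof.
move=> /topeP tX /face_leP XY; apply/ffunP => e; exact/XY/tX.
Qed.

Lemma reflect_in_face X Y : face_le X (reflect_in X Y).
Proof. by apply/face_leP => e; rewrite ffunE; case: (X e). Qed.

Lemma reflect_in_tope X Y : tope Y -> tope (reflect_in X Y).
Proof.
move=> /topeP tY; apply/topeP => e; rewrite ffunE; case: (X e) => //.
by move: (tY e); case: (Y e).
Qed.

Lemma reflect_inK X Y : face_le X Y -> reflect_in X (reflect_in X Y) = Y.
Proof.
move=> /face_leP XY; apply/ffunP => e; rewrite !ffunE.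
by move: (XY e); case: (X e) => [b ->//|_]; rewrite soppK.
Qed.

Lemma face_le_constrain k g s X : s <> None ->
  k g = None \/ k g = s ->
  face_le (constrain k g s) X = face_le k X && (X g == s).
Proof.
move=> sN kg; apply/face_leP/andP => [kX|[/face_leP kX /eqP Xg] e].
  split; last by have := kX g; rewrite ffunE eqxx => ->.
  apply/face_leP => e ke; have := kX e; rewrite ffunE.
  have [eg|_ ->//] := eqVneq e g.
  by move: kg ke; rewrite eg => -[->//|->] _; apply.
by rewrite ffunE; have [->|_ /kX//] := eqVneq.
Qed.

Lemma zeros_constrain k g b : k g = None ->
  zeros k = g |: zeros (constrain k g (Some b)).
Proof.
move=> kg; apply/finset.setP => e; rewrite !inE ffunE.
by have [->|] := eqVneq e g; rewrite ?kg ?eqxx.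
Qed.

(** What the combinatorial argument needs from the sign vectors L of the faces.
    In the geometric case rho Z is the parity sign of the codimension of the
    intersection of the hyperplanes in Z, and the region of the Euler relation
    consists of the faces contained in that intersection and in the apartment
    of k. *)
Record euler_covectors (Rg : comNzRingType) (L : {set covector})
    (rho : {set E} -> Rg) : Prop := EulerCovectors {
  covector_reflect : forall X Y, X \in L -> Y \in L -> reflect_in X Y \in L;
  covector_elim : forall X Y e b, X \in L -> Y \in L ->
    X e = Some b -> Y e = Some (~~ b) ->
    exists F, [/\ F \in L, F e = None & forall f, X f = Y f -> F f = X f];
  rho_sqr : forall Z, rho Z * rho Z = 1;
  rho_set1 : forall e, rho [set e]%SET = -1;
  euler_sum : forall Z k,
    (exists X, [/\ X \in L, Z \subset zeros X & face_le k X]) ->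
    \sum_(X in L | (Z \subset zeros X) && face_le k X) rho (zeros X) = rho Z }.

Section EulerCovectors.
Variables (Rg : comNzRingType) (L : {set covector}) (rho : {set E} -> Rg).
Hypothesis eulerL : euler_covectors L rho.

(** Removing one index g from S replaces its factor by p g on the whole region,
    corrected by r g - p g on the subregion where X has the sign of X0 at g.
    Both regions contain X0, so the Euler relation applies to both.  With r = 1 this
    evaluates detours; with r = 0 and p = 1 it counts a half-open region. *)
Lemma weighted_euler_sum Z k X0 S (r p : E -> Rg) :
  X0 \in L -> Z \subset zeros X0 -> face_le k X0 -> [disjoint S & zeros X0] ->
  \sum_(X in L | (Z \subset zeros X) && face_le k X)
    rho (zeros X) * \prod_(g in S) (if X g == X0 g then r g else p g)
  = rho Z * \prod_(g in S) r g.
Proof.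
move=> LX0 ZX0 kX0 dS; rewrite -[in RHS]big_enum /=.
under eq_bigr do rewrite -big_enum /=.
have: {in enum S, forall g, X0 g <> None}.
  by move=> g; rewrite mem_enum => /(disjointFr dS)/negbT; rewrite inE => /eqP.
elim: (enum S) k kX0 => [|g s IHs] k kX0 nzs.
  rewrite big_nil mulr1 -(euler_sum eulerL (Z := Z) (k := k)); last by exists X0.
  by apply: eq_bigr => X _; rewrite big_nil mulr1.
rewrite big_cons; under eq_bigr do rewrite big_cons.
have nz_s : {in s, forall g, X0 g <> None}.
  by move=> g' g's; apply: nzs; rewrite inE g's orbT.
have X0g : X0 g <> None by apply: nzs; rewrite mem_head.
have IHk := IHs k kX0 nz_s.
have kg : k g = None \/ k g = X0 g.
  by have [|/eqP/(elimT (face_leP _ _) kX0)] := eqVneq (k g) None; [left | right].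
have kcE := face_le_constrain _ X0g kg.
have := IHs (constrain k g (X0 g)); rewrite kcE kX0 eqxx => /(_ isT nz_s).
under eq_bigl do rewrite kcE; move=> IHc.
rewrite mulrCA -IHk.
transitivity (p g * \sum_(X in L | (Z \subset zeros X) && face_le k X)
       rho (zeros X) * \prod_(g0 <- s) (if X g0 == X0 g0 then r g0 else p g0)
   + (r g - p g) * \sum_(X in L | [&& Z \subset zeros X, face_le k X & X g == X0 g])
       rho (zeros X) * \prod_(g0 <- s) (if X g0 == X0 g0 then r g0 else p g0)).
  rewrite !big_distrr /= [X in _ + X]big_mkcond [X in X + _]big_mkcond /=.
  rewrite [LHS]big_mkcond -big_split /=; apply: eq_bigr => X _.
  case: (X \in L) (Z \subset zeros X) (face_le k X) => [] [] [] /=; rewrite ?addr0 //.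
  case: ifP => _; last by rewrite addr0 mulrCA.
  by rewrite -mulrDl addrCA subrr addr0 mulrCA.
by rewrite IHc IHk -mulrDl addrC subrK.
Qed.

(** * Distances and hinges *)
Variable h : E -> bool -> Rg.

Definition dist C D : Rg :=
  \prod_(e | C e != D e) (if C e is Some b then h e b else 1).

Definition pair_weight e : Rg := h e true * h e false.

Definition face_weight F : Rg := \prod_(e in zeros F) pair_weight e.

Lemma prod_mkcond2 (I : finType) (P Q : pred I) (u w : I -> Rg) :
  \prod_(i | P i) u i * \prod_(i | Q i) w i =
  \prod_i ((if P i then u i else 1) * (if Q i then w i else 1)).
Proof. by rewrite big_split -!big_mkcond. Qed.

(** A hyperplane separating F from both C and D is crossed twice by the detour
    and not at all by a direct path; all others are crossed equally often. *)
Lemma dist_detour C F D : tope C -> tope F -> tope D ->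
  dist C F * dist F D = dist C D *
    \prod_(e in [set e | C e == D e]%SET)
       (if F e == C e then 1 else pair_weight e).
Proof.
move=> /topeP tC /topeP tF /topeP tD.
rewrite /dist !prod_mkcond2; apply: eq_bigr => e _; rewrite inE /pair_weight.
move: (tC e) (tF e) (tD e).
by case: (C e) (F e) (D e) => [[]|] [[]|] [[]|] // _ _ _ /=;
  rewrite ?(mulr1, mul1r) // mulrC.
Qed.

Lemma dist_opposite F C : tope C -> face_le F C ->
  dist C (reflect_in F C) * dist (reflect_in F C) C = face_weight F.
Proof.
move=> /topeP tC /face_leP FC.
rewrite /dist /face_weight prod_mkcond2 [RHS]big_mkcond; apply: eq_bigr => e _.
rewrite ffunE inE /pair_weight; move: (tC e) (FC e).
case: (F e) => [b|]; first by move=> _ <- //; rewrite eqxx mulr1.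
by case: (C e) => [[]|] // _ _ /=; rewrite // mulrC.
Qed.

(** The coefficient of dist C D in the entry (C, D) of the transition matrix
    across H, for C and D on opposite sides of H.  The leading sign compensates
    for rho [set H] = -1. *)
Definition crossing k H C D : Rg :=
  - \sum_(F in L | [&& F H == None, face_le k F & reflect_in F D == C])
      rho (zeros F).

(** The combinatorial form of the condition that the closure of F be the
    intersection of H with the closure of C. *)
Definition hinge H F C : bool :=
  [&& F \in L, face_le F C, F H == None &
   [forall F' in L, face_le F' C && (F' H == None) ==> face_le F' F]].

Lemma hingeP H F C :
  reflect [/\ F \in L, face_le F C, F H = None &
    forall F', F' \in L -> face_le F' C -> F' H = None -> face_le F' F]
    (hinge H F C).
Proof.
apply: (iffP and4P) => [] [LF FC /eqP FH maxF]; split => //; try exact/eqP.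
  move=> F' LF' F'C F'H; have /forall_inP/(_ _ LF')/implyP := maxF; apply.
  by rewrite F'C F'H eqxx.
apply/forall_inP => F' LF'; apply/implyP => /andP[F'C /eqP F'H].
exact: maxF.
Qed.

Lemma hinge_uniq H F F' C : hinge H F C -> hinge H F' C -> F = F'.
Proof.
move=> /hingeP[LF FC FH maxF] /hingeP[LF' F'C F'H maxF'].
by apply: face_le_anti; [apply: maxF' | apply: maxF].
Qed.

(** Two faces F0 and F' of C lying in H have a common upper bound of the same
    kind, the composition of F0 with F', obtained by reflecting twice in F0.
    Hence a face with as few zeros as possible is the greatest. *)
Lemma hinge_exists H F C : F \in L -> face_le F C -> F H = None ->
  exists2 F0, hinge H F0 C & face_le F F0.
Proof.
move=> LF FC FH.
pose P X := [&& X \in L, face_le X C & X H == None].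
have P_F : P F by rewrite /P LF FC FH eqxx.
case: (@arg_minnP _ F P (fun X => #|zeros X|) P_F) => F0 /and3P[LF0 F0C /eqP F0H] minF0.
have maxF0 F' : F' \in L -> face_le F' C -> F' H = None -> face_le F' F0.
  move=> LF' F'C F'H; pose Y := reflect_in F0 (reflect_in F0 F').
  have LY : Y \in L by rewrite !(covector_reflect eulerL).
  have Ye e : Y e = if F0 e is Some b then Some b else F' e.
    by rewrite !ffunE; case: (F0 e) => // ; rewrite soppK.
  have F0Y : face_le F0 Y by apply: reflect_in_face.
  have YC : face_le Y C.
    apply/face_leP => e; rewrite Ye; have := elimT (face_leP _ _) F0C e.
    by case: (F0 e) => [b -> //|_ ]; apply: (elimT (face_leP _ _) F'C).
  have := minF0 Y; rewrite /P LY YC Ye F0H F'H eqxx => /(_ isT) le_card.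
  have /(face_le_eq F0Y) YF0 : zeros F0 \subset zeros Y.
    have := face_le_zeros F0Y => /subset_leqif_card/geq_leqif.
    by rewrite le_card => /esym/eqP/eqP ->.
  apply/face_leP => e F'e; rewrite YF0 Ye.
  have := elimT (face_leP _ _) F0C e.
  by case: (F0 e) => // b ->//; apply: (elimT (face_leP _ _) F'C).
exists F0; last exact: maxF0.
by apply/hingeP; split.
Qed.

(** Reflecting a face F' of the reflected chamber through F gives a face of C.
    When F' lies in H, so does that face, which is then below F; hence F' has a
    zero wherever F has one. *)
Lemma hinge_reflect H F C : hinge H F C -> hinge H F (reflect_in F C).
Proof.
move=> /hingeP[LF FC FH maxF]; apply/hingeP; split=> //.
  exact: reflect_in_face.
move=> F' LF' /face_leP F'C F'H.
have : face_le (reflect_in F F') F.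
  apply: maxF; first exact: (covector_reflect eulerL).
    apply/face_leP => e; rewrite ffunE; have := F'C e; rewrite ffunE.
    have := elimT (face_leP _ _) FC e.
    case: (F e) => [b ->//|_]; case: (F' e) => // b F'b _.
    by rewrite F'b ?soppK.
  by rewrite ffunE FH F'H.
move=> /face_leP FF'; apply/face_leP => e F'e; have := FF' e; have := F'C e F'e.
rewrite !ffunE; case: (F e) => // /[swap] F'0.
by move: F'e F'0; case: (F' e) => // b _ F'b _; have /F'b : sopp (Some b) <> None by [].
Qed.

Lemma reflect_in_eqP X C D : tope C -> tope D ->
  reflect (face_le X C /\ forall e, X e = None -> C e <> D e)
    (reflect_in X D == C).
Proof.
move=> /topeP tC /topeP tD; apply: (iffP eqP) => [<-|[/face_leP XC ne]].
  split=> [|e Xe]; first exact: reflect_in_face.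
  by rewrite ffunE Xe; case: (D e) (tD e) => [[]|].
apply/ffunP => e; rewrite ffunE; have := XC e; have := ne e.
case: (X e) => [b _ -> //|/(_ erefl) neCD _].
by move: (tC e) (tD e) neCD; case: (C e) (D e) => [[]|] [[]|].
Qed.

(** The faces counted by the coefficient form a half-open region of the flat of
    F, bounded by the hyperplanes separating C and D.  The face F' of D lies in
    this flat, strictly beyond all the closed boundaries, so the region counts
    for zero, unless it has no closed boundary at all: then D is the reflection
    of C through F. *)
Lemma crossing_same_flat k H F C F' D :
  tope C -> tope D -> face_le k C -> face_le k D ->
  hinge H F C -> F' \in L -> face_le F' D -> zeros F' = zeros F ->
  zeros F \subset [set e | C e != D e]%SET ->
  crossing k H C D =
    - (rho (zeros F) * (zeros F == [set e | C e != D e]%SET)%:R).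
Proof.
move=> tC tD /face_leP kC /face_leP kD /hingeP[LF /face_leP FC FH maxF].
move=> LF' /face_leP F'D zF' /fintype.subsetP subF.
(* k' imposes the open boundaries, and S lists the closed ones. *)
pose k' : covector := [ffun e => if C e == D e then C e else None].
pose S := ([set e | C e != D e] :\: zeros F)%SET.
have Z0 : zeros F \subset zeros F' by rewrite zF'.
have k'F' : face_le k' F'.
  apply/face_leP => e; rewrite ffunE; case: eqP => // CD _.
  by rewrite F'D // => /zerosP; rewrite zF' => /subF; rewrite inE CD eqxx.
have dS : [disjoint S & zeros F'].
  rewrite zF' -setI_eq0; apply/eqP/finset.setP => e; rewrite !inE.
  by case: (F e == None); rewrite ?andbF.
have := weighted_euler_sum (fun=> 0) (fun=> 1) LF' Z0 k'F' dS.
rewrite /crossing => sumE; congr (- _); move: sumE.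
have -> : \prod_(e in S) (0 : Rg) = (zeros F == [set e | C e != D e]%SET)%:R.
  rewrite prodr_const finset.eqEsubset.
  have -> : zeros F \subset [set e | C e != D e]%SET.
    exact/fintype.subsetP.
  rewrite -finset.setD_eq0 -cards_eq0 -/S; case: #|S| => [|m]; first by rewrite expr0.
  by rewrite exprS mul0r.
move<-; rewrite big_mkcond [RHS]big_mkcond; apply: eq_bigr => X _.
have [LX|//] := boolP (X \in L).
have prodE : \prod_(g in S) (if X g == F' g then 0 else 1 : Rg)
    = [forall g in S, X g != F' g]%:R.
  have [/forall_inP nX|/forall_inPn[g gS]] := boolP [forall g in S, X g != F' g].
    by apply: big1 => g /nX/negPf->.
  by rewrite negbK => Xg; rewrite (bigD1 g) //= Xg mul0r.
rewrite prodE /=.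
set b1 := [&& _, _ & _]; set b2 := _ && _; set b3 := FiniteQuant.quant0b _.
suff -> : b1 = b2 && b3 by case: b2 b3 => [] []; rewrite ?(mulr1, mulr0).
apply/and3P/idP => [[/eqP XH kX /(reflect_in_eqP _ tC tD)[XC XD]]|].
  have XF := maxF X LX XC XH; apply/andP; split; first (apply/andP; split).
  - exact: face_le_zeros.
  - apply/face_leP => e; rewrite ffunE; case: eqP => // CD _.
    have [/XD//|/eqP/(elimT (face_leP _ _) XC)] := eqVneq (X e) None.
    by move->.
  - apply/forall_inP => e; rewrite !inE => /andP[Fe CD].
    have [->|/eqP/(elimT (face_leP _ _) XC)->] := eqVneq (X e) None.
      by rewrite eq_sym; apply/eqP => /zerosP; rewrite zF' inE; exact/negP.
    by rewrite F'D // => /zerosP; rewrite zF' inE; exact/negP.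
move=> /andP[/andP[ZX /face_leP k'X] /forall_inP XS]; split.
- by apply/eqP/zerosP; apply: (fintype.subsetP ZX); apply/zerosP.
- apply/face_leP => e ke; have CD : C e = D e by rewrite -kC // kD.
  have := k'X e; rewrite ffunE CD eqxx -kD // => ->//.
apply/(reflect_in_eqP _ tC tD); split=> [|e Xe].
  apply/face_leP => e Xe; have [CD|CD] := eqVneq (C e) (D e).
    have := k'X e; rewrite ffunE CD eqxx => -> //; exact: (elimT (topeP _) tD e).
  have eS : e \in S.
    rewrite !inE CD andbT; apply/eqP => /zerosP /(fintype.subsetP ZX)/zerosP.
    exact: Xe.
  have := XS e eS; rewrite F'D; last first.
    by move=> /zerosP; rewrite (disjointFr dS eS).
  move: Xe CD (elimT (topeP _) tC e) (elimT (topeP _) tD e).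
  by case: (X e) (C e) (D e) => [[]|] [[]|] [[]|].
move=> CD; have := k'X e; rewrite ffunE CD eqxx Xe => De.
by have De0 := elimT (topeP _) tD e; exact/De0/De.
Qed.

Lemma crossing_opposite k H F C : tope C -> face_le k F -> hinge H F C ->
  crossing k H C (reflect_in F C) = - rho (zeros F).
Proof.
move=> tC kF hFC; have [LF FC FH _] := elimT (hingeP _ _ _) hFC.
have sepE : [set e | C e != reflect_in F C e]%SET = zeros F.
  apply/finset.setP => e; rewrite !inE ffunE; move/topeP/(_ e): tC.
  have := elimT (face_leP _ _) FC e.
  case: (F e) => [b <-//|_]; first by rewrite eqxx.
  by case: (C e) => // -[].
rewrite (crossing_same_flat (F' := F) (F := F)) ?sepE ?eqxx ?mulr1 //.
- exact: reflect_in_tope.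
- exact: face_le_trans FC.
- exact/(face_le_trans kF)/reflect_in_face.
- exact: reflect_in_face.
Qed.

Lemma crossing_neq0 k H C D : crossing k H C D != 0 ->
  exists F, [/\ F \in L, F H = None, face_le k F & reflect_in F D = C].
Proof.
move=> nz; have [F /andP[LF /and3P[/eqP FH kF /eqP FD]]|no] :=
  pickP [pred F in L | [&& F H == None, face_le k F & reflect_in F D == C]].
  by exists F.
case/eqP: nz; rewrite /crossing big1 ?oppr0 // => F P_F.
by have := no F; rewrite /= P_F.
Qed.

(** A nonzero coefficient provides a face F of H through which D reflects to C.
    Reflecting the hinge F1 of D through F gives a face of C in H, which lies
    below the hinge F0 of C; this compares the zeros of F0 and F1.  When they
    are equal, the previous evaluation of the coefficient on a flat applies. *)
Lemma crossing_hinge k H C D : tope C -> tope D -> face_le k C -> face_le k D ->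
  crossing k H C D != 0 ->
  exists F0, [/\ hinge H F0 C, face_le k F0 &
    forall F1, hinge H F1 D ->
      (#|zeros F0| < #|zeros F1|)%N \/ F0 = F1 /\ D = reflect_in F0 C].
Proof.
move=> tC tD kC kD nz; have [F [LF FH kF FDC]] := crossing_neq0 nz.
have FC : face_le F C by rewrite -FDC; apply: reflect_in_face.
have [F0 hF0 FF0] := hinge_exists LF FC FH.
exists F0; split=> //; first exact: face_le_trans FF0.
have [LF0 F0C F0H maxF0] := elimT (hingeP _ _ _) hF0.
move=> F1 /[dup] hF1 /hingeP[LF1 F1D F1H maxF1].
have sF01 : zeros F0 \subset zeros F1.
  have FF1 : face_le (reflect_in F F1) F0.
    apply: maxF0; first exact: (covector_reflect eulerL).
      apply/face_leP => e; rewrite -FDC !ffunE.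
      have := elimT (face_leP _ _) F1D e.
      by case: (F e) => // ; case: (F1 e) => // b -> .
    by rewrite ffunE FH F1H.
  apply: (fintype.subset_trans (face_le_zeros FF1)).
  apply/fintype.subsetP => e /zerosP; rewrite ffunE => Fe.
  by apply/zerosP; move: Fe; case: (F e) => //; case: (F1 e).
have [eqz|neqz] := eqVneq (zeros F0) (zeros F1); last first.
  by left; apply: proper_card; rewrite finset.properEneq neqz.
right; have subSep : zeros F0 \subset [set e | C e != D e]%SET.
  apply/fintype.subsetP => e /(fintype.subsetP (face_le_zeros FF0))/zerosP Fe.
  rewrite inE -FDC ffunE Fe; have := elimT (topeP _) tD e.
  by case: (D e) => // -[].
have := nz; rewrite (crossing_same_flat tC tD kC kD hF0 LF1 F1D) //.
have [zE _|_] := eqVneq (zeros F0) [set e | C e != D e]%SET; last first.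
  by rewrite mulr0 oppr0 eqxx.
have DE : D = reflect_in F0 C.
  apply/ffunP => e; rewrite ffunE; have := elimT (face_leP _ _) F0C e.
  have : (e \in zeros F0) = (C e != D e) by rewrite zE inE.
  rewrite inE; case: (F0 e) => [b|] /= CD Fe.
    by rewrite Fe //; symmetry; apply/eqP/negbFE; rewrite -CD.
  move: (esym CD); by have := elimT (topeP _) tD e; have := elimT (topeP _) tC e;
    case: (C e) (D e) => [[]|] [[]|].
by split=> //; apply: (hinge_uniq (hinge_reflect hF0)); rewrite -DE.
Qed.

(** Dividing out dist C D by the detour formula leaves an alternating sum of
    products of weights over the faces of H in the apartment.  A point where a
    segment from C to D meets H shows that the region where C and D agree is
    not empty. *)
Lemma sum_crossing k H C D :
  C \in L -> D \in L -> tope C -> tope D -> face_le k C -> face_le k D ->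
  k H = None -> C H != D H ->
  - \sum_(F in L | (F H == None) && face_le k F)
     rho (zeros F) * (dist C (reflect_in F D) * dist (reflect_in F D) D)
  = dist C D.
Proof.
move=> LC LD tC tD /face_leP kC /face_leP kD kH neqH.
have [b CH] : exists b, C H = Some b.
  by have := elimT (topeP _) tC H; case: (C H) => // b; exists b.
have DH : D H = Some (~~ b).
  move: (elimT (topeP _) tD H) neqH; rewrite CH.
  by case: (D H) => // c _; case: b {CH}; case: c.
have [X0 [LX0 X0H X0E]] := covector_elim eulerL LC LD CH DH.
have kX0 : face_le k X0.
  apply/face_leP => e ke; rewrite X0E; first exact: kC.
  by rewrite -kC // kD.
have H0 : [set H]%SET \subset zeros X0 by rewrite finset.sub1set; apply/zerosP.
have dS : [disjoint [set e | C e == D e]%SET & zeros X0].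
  rewrite -setI_eq0; apply/eqP/finset.setP => e; rewrite !inE.
  apply/negP => /andP[/eqP CDe]; rewrite X0E // => /eqP.
  exact: (elimT (topeP _) tC e).
have := weighted_euler_sum (fun=> 1) pair_weight LX0 H0 kX0 dS.
rewrite [X in _ = _ * X]big1 // mulr1 (rho_set1 eulerL) => sumE.
rewrite -[RHS]mulr1 -[1]opprK -sumE mulrN big_distrr; congr (- _).
apply: eq_big => [F|F /andP[LF /andP[FH kF]]].
  by rewrite finset.sub1set inE.
rewrite dist_detour ?reflect_in_tope //= mulrCA; congr (_ * (_ * _)).
apply: eq_bigr => e; rewrite inE => /eqP CDe; rewrite ffunE X0E // CDe.
by have := elimT (topeP _) tD e; case: (F e) (D e) => [[]|] [[]|].
Qed.

(** * Cutting an apartment by a hyperplane *)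
Variables (N : nat) (tp : 'I_N -> covector) (k0 : covector).
Hypothesis tp_inj : injective tp.
Hypothesis tpP : forall X, (X \in codom tp) = [&& X \in L, tope X & face_le k0 X].

Lemma tp_L i : tp i \in L.
Proof. by have := codom_f tp i; rewrite tpP => /and3P[]. Qed.

Lemma tp_tope i : tope (tp i).
Proof. by have := codom_f tp i; rewrite tpP => /and3P[]. Qed.

Lemma tp_sign i H : tp i H = Some (tp i H == Some true).
Proof. by have := elimT (topeP _) (tp_tope i) H; case: (tp i H) => [[]|]. Qed.

Lemma tp_ex X : X \in L -> tope X -> face_le k0 X -> exists i, tp i = X.
Proof.
move=> LX tX kX; have /codomP[i ->] : X \in codom tp by rewrite tpP LX tX.
by exists i.
Qed.

(** The matrices of all apartments inside that of k0 share one index set, being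
    completed by the identity.  The block matrix of two disjoint apartments is
    then the product of their matrices. *)
Definition cone_mx k : 'M[Rg]_N := \matrix_(i, j)
  if face_le k (tp i) && face_le k (tp j) then dist (tp i) (tp j)
  else (i == j)%:R.

Definition crossing_mx k H : 'M[Rg]_N := \matrix_(i, j)
  if [&& face_le k (tp i), face_le k (tp j) & tp i H != tp j H]
  then dist (tp i) (tp j) * crossing k H (tp i) (tp j) else (i == j)%:R.

(** Read in the row of C and the column of D: when H separates C from D, only
    the chambers on the side of C contribute, and they are the reflections of D
    through the faces of H in the apartment. *)
Lemma cone_mx_split k H : face_le k0 k -> k H = None ->
  cone_mx k = cone_mx (constrain k H (Some true)) *m
    cone_mx (constrain k H (Some false)) *m crossing_mx k H.
Proof.
move=> k0k kH; set kp := constrain k H (Some true).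
set kn := constrain k H (Some false).
have kcE b X : face_le (constrain k H (Some b)) X = face_le k X && (X H == Some b).
  by apply: face_le_constrain => //; left.
have mulE i j : (cone_mx kp *m cone_mx kn) i j =
    if face_le kp (tp i) then cone_mx kp i j else cone_mx kn i j.
  rewrite mxE; case: ifP => [kpi|kpi].
    rewrite (bigD1 j) //= [X in _ + X]big1 ?addr0.
      rewrite [cone_mx kn _ _]mxE eqxx; case: ifP; rewrite ?mulr1 //.
      rewrite andbb kcE => /andP[_ /eqP jH]; rewrite mxE kpi kcE jH andbF.
      have [ij|] := eqVneq i j; last by rewrite mul0r.
      by move: kpi; rewrite kcE ij jH => /andP[].
    move=> l lj; rewrite [cone_mx kn _ _]mxE (negPf lj).
    case: ifP; rewrite ?mulr0 // => /andP[+ _]; rewrite kcE => /andP[_ /eqP lH].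
    rewrite mxE kpi kcE lH andbF; have [il|] := eqVneq i l; last by rewrite mul0r.
    by move: kpi; rewrite kcE il lH => /andP[].
  rewrite (bigD1 i) //= [X in _ + X]big1 ?addr0.
    by rewrite mxE kpi eqxx mul1r.
  by move=> l li; rewrite mxE kpi eq_sym (negPf li) mul0r.
(* From here on, row i: first outside the apartment, then inside it, where s
   is the side of H on which the chamber of i lies. *)
apply/matrixP => i j; rewrite [RHS]mxE.
have [ki|ki] := boolP (face_le k (tp i)); last first.
  rewrite (bigD1 i) //= [X in _ + X]big1 ?addr0.
    by rewrite mulE !mxE !kcE (negPf ki) /= eqxx mul1r.
  move=> l li; rewrite mulE !mxE !kcE (negPf ki) /=.
  by rewrite eq_sym (negPf li) mul0r.
pose s := tp i H == Some true; have iH : tp i H = Some s by apply: tp_sign.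
pose ks := constrain k H (Some s).
transitivity (\sum_l cone_mx ks i l * crossing_mx k H l j); last first.
  apply: eq_bigr => l _; rewrite mulE kcE ki -/s /ks.
  by case: (s) => //=.
have ksi : face_le ks (tp i) by rewrite kcE ki iH eqxx.
transitivity (\sum_(l | face_le ks (tp l))
    dist (tp i) (tp l) * crossing_mx k H l j); last first.
  rewrite big_mkcond; apply: eq_bigr => l _; rewrite [cone_mx _ _ _]mxE ksi.
  case: ifP => // ksl; have [il|] := eqVneq i l; last by rewrite mul0r.
  by rewrite -il ksi in ksl.
have [kj|kj] := boolP (face_le k (tp j)); last first.
  rewrite mxE (negPf kj) andbF big1 => [|l].
    by have [ij|//] := eqVneq i j; rewrite -ij ki in kj.
  rewrite kcE => /andP[kl _]; rewrite mxE (negPf kj) andbF.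
  have [lj|] := eqVneq l j; last by rewrite mulr0.
  by rewrite -lj kl in kj.
rewrite mxE ki kj /=.
have [ijH|ijH] := eqVneq (tp i H) (tp j H).
  have ksj : face_le ks (tp j) by rewrite kcE kj -ijH iH eqxx.
  rewrite (bigD1 j) //= [X in _ + X]big1 ?addr0.
    by rewrite mxE eqxx !andbF eqxx mulr1.
  move=> l /andP[]; rewrite kcE => /andP[kl /eqP lH] lj.
  by rewrite mxE lH -ijH iH eqxx !andbF (negPf lj) mulr0.
rewrite -(sum_crossing (tp_L i) (tp_L j) (tp_tope i) (tp_tope j) ki kj kH ijH).
have -> : \sum_(l | face_le ks (tp l)) dist (tp i) (tp l) * crossing_mx k H l j
  = \sum_(l | face_le ks (tp l)) - \sum_(F in L | [&& F H == None, face_le k F &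
       reflect_in F (tp j) == tp l]) rho (zeros F) *
      (dist (tp i) (reflect_in F (tp j)) * dist (reflect_in F (tp j)) (tp j)).
  apply: eq_bigr => l; rewrite kcE => /andP[kl /eqP lH].
  rewrite mxE kl kj lH -iH ijH /= /crossing !mulrN; congr (- _).
  rewrite mulrA big_distrr /=; apply: eq_bigr => F /andP[_ /and3P[_ _ /eqP->]].
  by rewrite mulrC.
rewrite sumrN; congr (- _).
rewrite (exchange_big_dep [pred F in L | (F H == None) && face_le k F]) /=; last first.
  by move=> l F _ /andP[-> /and3P[-> ->]].
apply: eq_bigr => F /and3P[LF /eqP FH kF].
have kFj : face_le k (reflect_in F (tp j)).
  exact/(face_le_trans kF)/reflect_in_face.
have [l lE] : exists l, tp l = reflect_in F (tp j).
  apply: tp_ex; first exact: (covector_reflect eulerL) LF (tp_L j).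
    exact/reflect_in_tope/tp_tope.
  exact: face_le_trans k0k kFj.
rewrite (big_pred1 l) // => l'; rewrite /= LF FH kF eqxx /= -lE (inj_eq tp_inj).
rewrite eq_sym; apply/andP/eqP => [[_ /eqP//]|->]; split=> //.
rewrite kcE lE kFj ffunE FH; move: ijH; rewrite iH (tp_sign j).
by case: (s) (tp j H == Some true) => [] [].
Qed.

(** The integer beta_F of the theorem, computed with the hyperplane H. *)
Definition multiplicity H F : nat :=
  (#|[set C in L | tope C && hinge H F C]%SET| %/ 2)%N.

(** Reflection through F exchanges the chambers with hinge F on the two sides of
    H, so that the division by 2 is exact. *)
Lemma multiplicity_half H F b : F \in L -> F H = None ->
  #|[set C in L | [&& tope C, hinge H F C & C H == Some b]]%SET|
    = multiplicity H F.
Proof.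
move=> LF FH; rewrite /multiplicity.
pose T c := [set C in L | [&& tope C, hinge H F C & C H == Some c]]%SET.
have leT c : (#|T (~~ c)| <= #|T c|)%N.
  apply: leq_trans (leq_imset_card (reflect_in F) (T c)).
  apply/subset_leq_card/fintype.subsetP => C; rewrite inE.
  case/and4P=> LC tC hC /eqP CH; apply/imsetP; exists (reflect_in F C).
    rewrite inE (covector_reflect eulerL) // reflect_in_tope // hinge_reflect //=.
    by rewrite ffunE FH CH /= negbK.
  by rewrite reflect_inK //; case/hingeP: hC.
have eqT c : #|T c| = #|T b|.
  have [->//|cb] := eqVneq c b.
  have -> : c = ~~ b by case: c b cb => [] [].
  by apply/eqP; rewrite eqn_leq leT /= -{1}[b]negbK leT.
have -> : [set C in L | tope C && hinge H F C]%SET = (T true :|: T false)%SET.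
  apply/finset.setP => C; rewrite !inE; case: (C \in L) => //=.
  have [tC|//] := boolP (tope C); have := elimT (topeP _) tC H.
  by case: (C H) => [[]|] //; rewrite ?andbT ?andbF ?orbF.
rewrite cardsU (_ : (_ :&: _)%SET = finset.set0) ?cards0 ?subn0.
  by rewrite !eqT addnn -muln2 mulnK.
apply/finset.setP => C; rewrite !inE; case: (C H) => [[]|]; rewrite ?andbF //.
Qed.

Section CrossingDeterminant.
Variables (k : covector) (H : E).
Hypotheses (k0k : face_le k0 k) (kH : k H = None).

Definition hinge_in C : option covector :=
  [pick F | hinge H F C && face_le k F].

(** The reflection of a chamber through its hinge.  Chambers without a hinge in
    the apartment are their own mates. *)
Definition mate i : 'I_N :=
  if hinge_in (tp i) is Some F
  then odflt i [pick j | tp j == reflect_in F (tp i)] else i.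

(** Chambers without a hinge in the apartment come last: by [crossing_hinge],
    their rows in the transition matrix vanish off the diagonal. *)
Definition hinge_rank i : nat :=
  if hinge_in (tp i) is Some F then #|zeros F| else #|E|.+1.

Lemma hinge_inE F C : hinge H F C -> face_le k F -> hinge_in C = Some F.
Proof.
move=> hF kF; rewrite /hinge_in; case: pickP => [F' /andP[hF' _]|/(_ F)].
  by rewrite (hinge_uniq hF hF').
by rewrite hF kF.
Qed.

Lemma hinge_inP C F : hinge_in C = Some F -> hinge H F C /\ face_le k F.
Proof.
by rewrite /hinge_in; case: pickP => // F' /andP[hF kF] [<-].
Qed.

Lemma mateE i F : hinge H F (tp i) -> face_le k F ->
  tp (mate i) = reflect_in F (tp i).
Proof.
move=> hF kF; rewrite /mate (hinge_inE hF kF); case: pickP => [j /eqP//|no].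
have [LF _ _ _] := elimT (hingeP _ _ _) hF.
have [j jE] : exists j, tp j = reflect_in F (tp i).
  apply: tp_ex; first exact: (covector_reflect eulerL) LF (tp_L i).
    exact/reflect_in_tope/tp_tope.
  exact/(face_le_trans k0k)/(face_le_trans kF)/reflect_in_face.
by have := no j; rewrite jE eqxx.
Qed.

Lemma hinge_in_mate i : hinge_in (tp (mate i)) = hinge_in (tp i).
Proof.
case hE: (hinge_in (tp i)) => [F|]; last by rewrite /mate hE hE.
have [hF kF] := hinge_inP hE; rewrite (mateE hF kF).
exact/hinge_inE/kF/hinge_reflect.
Qed.

Lemma mateK : involutive mate.
Proof.
move=> i; case hE: (hinge_in (tp i)) => [F|]; last first.
  have mi : mate i = i by rewrite /mate hE.
  by rewrite !mi.
have [hF kF] := hinge_inP hE; apply: tp_inj; rewrite (@mateE _ F) //.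
  by rewrite (mateE hF kF) reflect_inK //; case/hingeP: hF.
by rewrite (mateE hF kF); apply: hinge_reflect.
Qed.

Lemma mate_side i F : hinge H F (tp i) -> face_le k F ->
  tp (mate i) H = sopp (tp i H).
Proof.
by move=> hF kF; rewrite (mateE hF kF) ffunE; case/hingeP: hF => _ _ -> _.
Qed.

Lemma mate_neq i F : hinge H F (tp i) -> face_le k F -> mate i != i.
Proof.
move=> hF kF; apply/eqP => mi; have := mate_side hF kF; rewrite mi tp_sign.
by case: (_ == _).
Qed.

Lemma mate_fix i : hinge_in (tp i) = None -> mate i = i.
Proof. by rewrite /mate => ->. Qed.

(** The product over pairs of mates is regrouped according to their hinges; the
    two entries of a pair multiply to b_F, since the two distances give b_F and
    both coefficients are - rho (zeros F), a square root of 1. *)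
Lemma det_crossing_mx : \det (crossing_mx k H) =
  \prod_(F in L | (F H == None) && face_le k F)
    (1 - face_weight F) ^+ multiplicity H F.
Proof.
pose pos i := tp i H == Some true.
rewrite (@det_order_matched _ _ _ hinge_rank pos mate).
- transitivity (\prod_(i | ~~ pos i)
    \prod_(F in L | [&& F H == None, face_le k F & hinge H F (tp i)])
       (1 - face_weight F)).
    rewrite [RHS](bigID [pred i | mate i != i]) /= -[LHS]mulr1; congr (_ * _).
      apply: eq_bigr => i /andP[pi mi].
      case hE: (hinge_in (tp i)) => [F|]; last by rewrite mate_fix ?eqxx in mi.
      have [hF kF] := hinge_inP hE; have [LF Fi FH _] := elimT (hingeP _ _ _) hF.
      rewrite (big_pred1 F) => [|F' /=]; last first.
        apply/and4P/eqP => [[_ _ _ hF']|->]; first exact: hinge_uniq hF' hF.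
        by rewrite FH.
      have ki : face_le k (tp i) by apply: face_le_trans Fi.
      have hFm : hinge H F (reflect_in F (tp i)) by apply: hinge_reflect.
      have kmi : face_le k (reflect_in F (tp i)).
        exact/(face_le_trans kF)/reflect_in_face.
      have sidei : tp i H != sopp (tp i H) by rewrite tp_sign; case: (tp i H == _).
      rewrite !mxE (mateE hF kF) ki kmi ffunE FH /= sidei eq_sym sidei /=.
      have back : crossing k H (reflect_in F (tp i)) (tp i) = - rho (zeros F).
        rewrite -[in X in crossing _ _ _ X](reflect_inK Fi).
        by rewrite crossing_opposite ?reflect_in_tope ?tp_tope.
      rewrite back crossing_opposite ?tp_tope //.
      by rewrite mulrACA dist_opposite ?tp_tope // mulrNN (rho_sqr eulerL) mulr1.
    symmetry; apply: big1 => i /andP[pi /negPn/eqP mi]; apply: big_pred0 => F.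
    apply/and4P => -[_ _ kF hF].
    by have := mate_neq hF kF; rewrite mi eqxx.
  rewrite (exchange_big_dep [pred F in L | (F H == None) && face_le k F]) /=.
    apply: eq_bigr => F /and3P[LF /eqP FH kF]; rewrite prodr_const.
    congr (_ ^+ _); rewrite -(multiplicity_half false LF FH).
    rewrite -(card_imset _ tp_inj); apply: eq_card => C.
    apply/imsetP/setIdP => [[i]|[LC /and3P[tC hC /eqP CH]]].
      rewrite unfold_in LF FH kF /= => /andP[pi hi] ->; rewrite tp_L tp_tope hi.
      by split=> //; rewrite tp_sign -/(pos i) (negPf pi).
    have [_ FC _ _] := elimT (hingeP _ _ _) hC.
    have [i iE] := tp_ex LC tC (face_le_trans k0k (face_le_trans kF FC)).
    by exists i => //; rewrite unfold_in LF FH kF iE hC /pos iE CH.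
  by move=> i F _ /andP[-> /and3P[-> ->]].
- exact: mateK.
- by move=> i; rewrite /hinge_rank hinge_in_mate.
- move=> i; case hE: (hinge_in (tp i)) => [F|]; last by rewrite mate_fix ?eqxx.
  have [hF kF] := hinge_inP hE; rewrite /pos (mate_side hF kF) => _.
  by case: (tp i H) (elimT (topeP _) (tp_tope i) H) => [[]|].
- by move=> i; rewrite mxE !eqxx !andbF.
move=> i j ij; rewrite mxE (negPf ij); case: ifP => [/and3P[ki kj ijH]|_]; last first.
  by rewrite eqxx.
move=> nz; have {}nz : crossing k H (tp i) (tp j) != 0.
  by apply: contraNneq nz => ->; rewrite mulr0.
have [F0 [hF0 kF0 minF0]] := crossing_hinge (tp_tope i) (tp_tope j) ki kj nz.
rewrite /hinge_rank (hinge_inE hF0 kF0).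
case hE: (hinge_in (tp j)) => [F1|]; last by left; rewrite ltnS max_card.
have [hF1 kF1] := hinge_inP hE; case: (minF0 F1 hF1) => [|[_ jE]]; first by left.
by right; apply: tp_inj; rewrite (mateE hF0 kF0).
Qed.

End CrossingDeterminant.

Lemma cone_mx_tope k : tope k -> cone_mx k = 1%:M.
Proof.
move=> tk; apply/matrixP => i j; rewrite !mxE.
case: ifP => // /andP[/(tope_face_le_eq tk) ki /(tope_face_le_eq tk) kj].
have ij : i = j by apply: tp_inj; rewrite -ki -kj.
by rewrite ij eqxx /dist big_pred0 // => e; rewrite eqxx.
Qed.

Lemma det_cone_mx_split k H : face_le k0 k -> k H = None ->
  \det (cone_mx k) =
    \det (cone_mx (constrain k H (Some true))) *
    \det (cone_mx (constrain k H (Some false))) *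
    \prod_(F in L | (F H == None) && face_le k F)
       (1 - face_weight F) ^+ multiplicity H F.
Proof.
by move=> k0k kH; rewrite (cone_mx_split k0k kH) !det_mulmx det_crossing_mx.
Qed.

End EulerCovectors.

(** * The determinant of an apartment *)
Section VarchenkoProduct.
Variables (Rg : idomainType) (L : {set covector}) (rho : {set E} -> Rg).
Hypothesis eulerL : euler_covectors L rho.
Variable h : E -> bool -> Rg.
Hypothesis weight_powers : forall F, F \in L -> ~~ tope F ->
  injective (fun m => (1 - face_weight h F) ^+ m).
Variables (N : nat) (tp : 'I_N -> covector) (k0 : covector).
Hypothesis tp_inj : injective tp.
Hypothesis tpP : forall X, (X \in codom tp) = [&& X \in L, tope X & face_le k0 X].

Lemma weight_neq0 F : F \in L -> ~~ tope F -> 1 - face_weight h F != 0.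
Proof.
move=> LF tF; apply/eqP => w0.
have /(weight_powers LF tF) : (1 - face_weight h F) ^+ 1 = (1 - face_weight h F) ^+ 2.
  by rewrite w0 !expr0n.
by [].
Qed.

(** The exponent mu F is allowed to come from a different hyperplane for each F,
    and the induction hypothesis is used for several functions mu: comparing two
    of them at the apartment of F shows that the multiplicity of F does not
    depend on the hyperplane.  This covers all faces F of the apartment of k
    except k itself, when k is a face; in that case the apartment is cut by the
    very hyperplane that defines mu k. *)
Lemma det_cone_mx k (mu : covector -> nat) : face_le k0 k ->
  (forall F, F \in L -> ~~ tope F ->
     exists2 e, F e = None & mu F = multiplicity L e F) ->
  \det (cone_mx h tp k) =
    \prod_(F in L | ~~ tope F && face_le k F)
      (1 - face_weight h F) ^+ mu F.
Proof.
have [m] := ubnP #|zeros k|; elim: m => // m IHm in k mu *.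
rewrite ltnS => le_k k0k muP.
have [H0 kH0|k_tope] := pickP [pred e | k e == None]; last first.
  have tk : tope k by apply/forallP => e; rewrite (negbT (k_tope e)).
  rewrite (cone_mx_tope _ tp_inj tk) det1 big_pred0 // => F.
  apply/and3P => -[_ tF /(tope_face_le_eq tk) kF].
  by rewrite -kF tk in tF.
have ntk : ~~ tope k by apply/forallPn; exists H0; rewrite negbK.
have [H kH Hmu] : exists2 H, k H = None & (k \in L -> mu k = multiplicity L H k).
  have [Lk|_] := boolP (k \in L); last by exists H0; first exact/eqP.
  by have [H kH muk] := muP k Lk ntk; exists H.
have kcE b X : face_le (constrain k H (Some b)) X = face_le k X && (X H == Some b).
  by apply: face_le_constrain => //; left.
have k0c b : face_le k0 (constrain k H (Some b)).
  apply: (face_le_trans k0k); apply/face_leP => e; rewrite ffunE.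
  by have [->|//] := eqVneq e H; rewrite kH.
have zc b : (#|zeros (constrain k H (Some b))| < m)%N.
  apply: leq_trans le_k; rewrite (zeros_constrain b kH) cardsU1 inE ffunE eqxx.
  by rewrite add1n.
rewrite (det_cone_mx_split eulerL h tp_inj tpP k0k kH).
rewrite (IHm _ mu (zc true) (k0c true) muP) (IHm _ mu (zc false) (k0c false) muP).
have nt F : F H = None -> ~~ tope F.
  by move=> FH; apply/forallPn; exists H; rewrite FH.
have -> : \prod_(F in L | (F H == None) && face_le k F)
       (1 - face_weight h F) ^+ multiplicity L H F =
    \prod_(F in L | (F H == None) && face_le k F)
       (1 - face_weight h F) ^+ mu F.
  apply: eq_bigr => F /and3P[LF /eqP FH kF]; congr (_ ^+ _).
  have [Fk|neqFk] := eqVneq F k; first by rewrite Fk Hmu -?Fk.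
  have zF : (#|zeros F| < m)%N.
    apply: leq_trans le_k; apply: proper_card.
    rewrite finset.properEneq face_le_zeros // andbT.
    apply: contra_neq neqFk => zFk.
    by apply/esym/(face_le_eq kF); rewrite zFk.
  have k0F := face_le_trans k0k kF.
  (* mu' differs from mu at F only, where it is computed with H. *)
  pose mu' X := if X == F then multiplicity L H F else mu X.
  have mu'P X : X \in L -> ~~ tope X ->
      exists2 e, X e = None & mu' X = multiplicity L e X.
    by rewrite /mu'; case: eqP => [-> _ _|_]; [exists H | apply: muP].
  have detF := IHm F mu zF k0F muP.
  have detF' := IHm F mu' zF k0F mu'P.
  have P_F : [&& F \in L, ~~ tope F & face_le F F].
    by rewrite LF nt // face_le_refl.
  rewrite detF in detF'; rewrite [LHS](bigD1 F P_F) [RHS](bigD1 F P_F) in detF'.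
  move: detF'; rewrite /mu' eqxx -/mu'.
  set rest := \prod_(_ | _) _; set rest' := \prod_(_ | _) _.
  have <- : rest = rest'.
    by apply: eq_bigr => X /andP[_ /negPf->].
  have rest0 : rest != 0.
    apply/prodf_neq0 => X /andP[/and3P[LX tX _] _].
    exact/expf_neq0/weight_neq0.
  by move=> /(mulIf rest0)/(weight_powers LF (nt F FH))->.
rewrite [RHS](bigID [pred F : covector | F H == None]) /=.
rewrite [X in _ = _ * X](bigID [pred F : covector | F H == Some true]) /=.
rewrite mulrC; congr (_ * (_ * _)); apply: eq_bigl => F; rewrite ?kcE.
- case: (F \in L) => //=; case: eqP => [/nt->//|_]; by rewrite ?andbT ?andbF.
- by case: (F H) => [[]|]; rewrite ?andbT ?andbF.
- by case: (F H) => [[]|]; rewrite ?andbT ?andbF.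
Qed.

End VarchenkoProduct.
End Covectors.

(** * Sign vectors of an affine arrangement *)
Section AffineCovectors.
Variables (R : realType) (n : nat) (E : finType).
Variables (a : E -> 'rV[R]_n) (c : E -> R).
Local Notation covector := {ffun E -> sign}.
Implicit Types (x y d : 'rV[R]_n) (e g : E) (u w t : R).

Definition sign_of u : sign :=
  if 0 < u then Some true else if u < 0 then Some false else None.

Lemma sign_of_neg u : u < 0 -> sign_of u = Some false.
Proof. by move=> u0; rewrite /sign_of u0 ltNge ltW. Qed.

Lemma sign_of_pos u : 0 < u -> sign_of u = Some true.
Proof. by rewrite /sign_of => ->. Qed.

Lemma sign_of0 : sign_of 0 = None.
Proof. by rewrite /sign_of ltxx. Qed.

Lemma sign_of_eq0 u : sign_of u = None -> u = 0.
Proof.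
by have [/sign_of_pos->|/sign_of_neg->|//] := ltgtP 0 u.
Qed.

Lemma sign_of_opp u : sign_of (- u) = sopp (sign_of u).
Proof.
have [u0|u0|<-] := ltgtP 0 u; last by rewrite oppr0 sign_of0.
  by rewrite (sign_of_pos u0) sign_of_neg // oppr_lt0.
by rewrite (sign_of_neg u0) sign_of_pos // oppr_gt0.
Qed.

Lemma sign_of_scale t u : 0 < t -> sign_of (t * u) = sign_of u.
Proof. by move=> t0; rewrite /sign_of pmulr_rgt0 // pmulr_rlt0. Qed.

Lemma sign_of_perturb u w : `|w| < `|u| -> sign_of (u + w) = sign_of u.
Proof.
have [u0|u0|<-] := ltgtP 0 u; last by rewrite normr0 normr_lt0.
  rewrite (gtr0_norm u0) ltr_norml => /andP[w1 _]; rewrite !sign_of_pos //.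
  lra.
rewrite (ltr0_norm u0) ltr_norml => /andP[_ w1]; rewrite !sign_of_neg //.
lra.
Qed.

Lemma sign_of_convex t u w : 0 < t -> t < 1 -> sign_of u = sign_of w ->
  sign_of (u + t * (w - u)) = sign_of u.
Proof.
move=> t0 t1; have [u0|u0|<-] := ltgtP 0 u.
- have [w0 _|/sign_of_neg->|<-] := ltgtP 0 w; rewrite ?(sign_of_pos u0) ?sign_of0 //.
  by rewrite sign_of_pos //; nra.
- have [/sign_of_pos->|w0 _|<-] := ltgtP 0 w; rewrite ?(sign_of_neg u0) ?sign_of0 //.
  by rewrite sign_of_neg //; nra.
by rewrite sign_of0 => /esym/sign_of_eq0->; rewrite subr0 mulr0 addr0 sign_of0.
Qed.

Lemma dotpDr (b x y : 'rV[R]_n) : dotp b (x + y) = dotp b x + dotp b y.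
Proof. by rewrite -big_split; apply: eq_bigr => i _; rewrite mxE mulrDr. Qed.

Lemma dotpZr (b x : 'rV[R]_n) t : dotp b (t *: x) = t * dotp b x.
Proof. by rewrite [RHS]big_distrr; apply: eq_bigr => i _; rewrite mxE mulrCA. Qed.

Lemma dotpBr (b x y : 'rV[R]_n) : dotp b (x - y) = dotp b x - dotp b y.
Proof. by rewrite -scaleN1r dotpDr dotpZr mulN1r. Qed.

Definition level e x : R := dotp (a e) x - c e.

Lemma level_move e x d t : level e (x + t *: d) = level e x + t * dotp (a e) d.
Proof. by rewrite /level dotpDr dotpZr addrAC. Qed.

Lemma dotp_level e x y : dotp (a e) (x - y) = level e x - level e y.
Proof. by rewrite dotpBr /level; ring. Qed.

Definition covector_at x : covector := [ffun e => sign_of (level e x)].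

Definition affine_covectors : {set covector} :=
  [set X | `[< exists x, covector_at x = X >]]%SET.

Lemma affine_covectorsP X :
  reflect (exists x, covector_at x = X) (X \in affine_covectors).
Proof. by rewrite inE; apply: asboolP. Qed.

Lemma covector_at_in x : covector_at x \in affine_covectors.
Proof. by apply/affine_covectorsP; exists x. Qed.

(** The inverse of 1 plus the sum of all the quotients |w e| / |u e| is less than
    the inverse of each of them. *)
Lemma small_scale (u w : E -> R) :
  exists2 t, 0 < t & forall e, u e != 0 -> `|t * w e| < `|u e|.
Proof.
pose s := \sum_e `|w e| / `|u e|.
have s0 : 0 <= s by apply: sumr_ge0 => e _; rewrite divr_ge0.
exists (1 + s)^-1; first by rewrite invr_gt0; lra.
move=> e ue; rewrite normrM gtr0_norm ?invr_gt0; last by lra.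
rewrite mulrC ltr_pdivrMr; last by lra.
rewrite -[X in X < _]mulr1 -{1}(divff (_ : `|u e| != 0)) ?normr_eq0 //.
rewrite mulrCA ltr_pM2l ?normr_gt0 // /s (bigD1 e) //=.
have : 0 <= \sum_(i | i != e) `|w i| / `|u i|.
  by apply: sumr_ge0 => i _; rewrite divr_ge0.
by lra.
Qed.

(** A small enough step in direction d keeps the nonzero signs, and replaces the
    zero ones by those of d. *)
Lemma covector_germ x d : exists2 t, 0 < t & covector_at (x + t *: d) =
  [ffun e => if level e x == 0 then sign_of (dotp (a e) d)
             else sign_of (level e x)].
Proof.
have [t t0 tP] := small_scale (level^~ x) (fun e => dotp (a e) d).
exists t => //; apply/ffunP => e; rewrite !ffunE level_move.
have [->|nz] := eqVneq (level e x) 0; first by rewrite add0r sign_of_scale.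
exact/sign_of_perturb/tP.
Qed.

Lemma affine_reflect X Y : X \in affine_covectors -> Y \in affine_covectors ->
  reflect_in X Y \in affine_covectors.
Proof.
move=> /affine_covectorsP[x <-] /affine_covectorsP[y <-].
have [t _ tE] := covector_germ x (x - y); apply/affine_covectorsP.
exists (x + t *: (x - y)); rewrite tE; apply/ffunP => e; rewrite !ffunE.
have [xe|nz] := eqVneq (level e x) 0.
  by rewrite dotp_level xe sign_of0 sub0r sign_of_opp.
case sx: (sign_of (level e x)) => [//|].
by rewrite (sign_of_eq0 sx) eqxx in nz.
Qed.

Lemma affine_elim X Y e b : X \in affine_covectors -> Y \in affine_covectors ->
  X e = Some b -> Y e = Some (~~ b) ->
  exists F, [/\ F \in affine_covectors, F e = None &
    forall f, X f = Y f -> F f = X f].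
Proof.
move=> /affine_covectorsP[x <-] /affine_covectorsP[y <-]; rewrite !ffunE => xe ye.
pose t := level e x / (level e x - level e y).
have [t0 t1 te] : [/\ 0 < t, t < 1 & level e x + t * (level e y - level e x) = 0].
  have [[lx ly]|[lx ly]] : 0 < level e x /\ level e y < 0 \/
      level e x < 0 /\ 0 < level e y.
    move: xe ye; rewrite /sign_of.
    have [x0|x0|//] := ltgtP 0 (level e x);
      have [y0|y0|//] := ltgtP 0 (level e y);
      by case: (b) => // _ _; first [by left | by right].
  all: clear xe ye.
  - have nz : 0 < level e x - level e y by lra.
    split; rewrite /t; first by rewrite divr_gt0 //; lra.
      by rewrite ltr_pdivrMr //; lra.
    by field; lra.
  - have nz : 0 < level e y - level e x by lra.
    have -> : t = (- level e x) / (level e y - level e x) by rewrite /t; field; lra.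
    split; first by rewrite divr_gt0 //; lra.
      by rewrite ltr_pdivrMr //; lra.
    by field; lra.
exists (covector_at (x + t *: (y - x))); split; first exact: covector_at_in.
  by rewrite ffunE level_move dotp_level te sign_of0.
by move=> f; rewrite !ffunE level_move dotp_level => /(sign_of_convex t0 t1).
Qed.

Definition normal_span (Z : {set E}) : 'M[R]_n := (\sum_(e in Z) <<a e>>)%MS.

Lemma mulmx_dotp m (b : 'rV[R]_n) (M : 'M_(n, m)) j :
  (b *m M) 0 j = dotp b (col j M)^T.
Proof. by rewrite mxE; apply: eq_bigr => i _; rewrite !mxE. Qed.

Lemma sub_normal_span (Z : {set E}) e : e \in Z -> (a e <= normal_span Z)%MS.
Proof.
by move=> eZ; rewrite -[(a e <= _)%MS]genmxE; apply: (sumsmx_sup e).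
Qed.

Lemma normal_spanU1 g (Z : {set E}) :
  (normal_span (g |: Z)%SET :=: a g + normal_span Z)%MS.
Proof.
apply/eqmxP/andP; split.
  apply/sumsmx_subP => e; rewrite !inE genmxE => /predU1P[->|eZ].
    exact: addsmxSl.
  exact/(submx_trans (sub_normal_span eZ))/addsmxSr.
rewrite addsmx_sub sub_normal_span ?finset.setU11 //.
by apply/sumsmx_subP => e eZ; rewrite genmxE sub_normal_span // inE eZ orbT.
Qed.

(** A linear form in the span of the forms indexed by Z is constant on the
    differences of points of the flat of Z; the form of g is not, as it takes
    different signs on two points. *)
Lemma normal_span_vary X Y (Z : {set E}) g :
  X \in affine_covectors -> Y \in affine_covectors ->
  Z \subset zeros X -> Z \subset zeros Y -> X g != Y g ->
  \rank (normal_span (g |: Z)%SET) = (\rank (normal_span Z)).+1.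
Proof.
move=> /affine_covectorsP[x <-] /affine_covectorsP[y <-] Zx Zy.
rewrite !ffunE => xy; rewrite normal_spanU1.
have ng : ~~ (a g <= normal_span Z)%MS.
  apply: contra_neqN xy => ag; congr sign_of; apply/eqP.
  rewrite -subr_eq0 -dotp_level; have /sub_kermxP : (a g <= kermx (x - y)^T)%MS.
    apply: (submx_trans ag); apply/sumsmx_subP => e eZ; rewrite genmxE.
    apply/sub_kermxP/matrixP => i j; rewrite !ord1 mulmx_dotp mxE.
    have -> : (col 0 (x - y)^T)^T = x - y by apply/matrixP => k l; rewrite !mxE ord1.
    rewrite dotp_level.
    have := fintype.subsetP Zx e eZ; have := fintype.subsetP Zy e eZ.
    by rewrite !inE !ffunE => /eqP/sign_of_eq0-> /eqP/sign_of_eq0->; rewrite subr0.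
  move=> /matrixP/(_ 0 0); rewrite mulmx_dotp mxE => /eqP.
  by have -> : (col 0 (x - y)^T)^T = x - y by apply/matrixP => k l; rewrite !mxE ord1.
apply/eqP; rewrite eqn_leq; apply/andP; split.
  apply: leq_trans (mxrank_adds_leqif _ _) _.
  exact: leq_add (rank_leq_row _) (leqnn _).
apply: rank_ltmx; rewrite ltmxE addsmxSr /=.
by apply: contra ng; apply: submx_trans (addsmxSl _ _).
Qed.

(** If a normal vector of a hyperplane containing X were outside the span for Z,
    some direction along the flat of Z would be transverse to that hyperplane,
    and a small step in this direction would leave X for a larger face. *)
Lemma normal_span_zeros X (Z : {set E}) : X \in affine_covectors ->
  Z \subset zeros X ->
  (forall Y, Y \in affine_covectors -> Z \subset zeros Y -> face_le X Y -> Y = X) ->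
  \rank (normal_span (zeros X)) = \rank (normal_span Z).
Proof.
move=> /affine_covectorsP[x xX] ZX maxX; apply/eqP; rewrite eqn_leq.
apply/andP; split; apply: mxrankS; apply/sumsmx_subP => g; rewrite genmxE; last first.
  by move=> gZ; apply/sub_normal_span/(fintype.subsetP ZX).
move=> gX; apply: contraT; rewrite submxE => /eqP nz.
(* The columns of the cokernel are the directions along the flat of Z. *)
have [j nzj] : exists j, dotp (a g) (col j (cokermx (normal_span Z)))^T != 0.
  apply/existsP; apply: contraT => /existsPn all0; case: nz; apply/matrixP => i j.
  by rewrite ord1 mulmx_dotp mxE; apply/eqP; have := all0 j; rewrite negbK.
set d := (_)^T in nzj; have [t _ tE] := covector_germ x d.
set Y := covector_at _ in tE; have YX : Y = X.
  apply: maxX; first exact: covector_at_in.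
    apply/fintype.subsetP => e eZ; have := fintype.subsetP ZX e eZ.
    rewrite !inE -xX tE !ffunE => /eqP/sign_of_eq0->; rewrite eqxx /d -mulmx_dotp.
    have := sub_normal_span eZ; rewrite submxE => /eqP->.
    by rewrite mxE sign_of0.
  apply/face_leP => e; rewrite -xX tE !ffunE.
  by have [->|//] := eqVneq (level e x) 0; rewrite sign_of0.
have := gX; rewrite inE -YX tE ffunE; move: gX; rewrite inE -xX ffunE.
move=> /eqP/sign_of_eq0->; rewrite eqxx => /eqP/sign_of_eq0 dg.
by rewrite dg eqxx in nzj.
Qed.

Variable Rg : comNzRingType.
Definition codim_sign (Z : {set E}) : Rg := (-1) ^+ \rank (normal_span Z).

Hypothesis a_neq0 : forall e, a e != 0.

(** Either the region consists of a single face, whose codimension is that of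
    the flat of Z, or some hyperplane g takes several signs on it.  In that case
    g cuts the region into two open parts, each with the codimension of the
    region, and a common wall of codimension one more: the sum is that of the
    region twice plus once with the opposite sign. *)
Lemma affine_euler_sum (Z : {set E}) k :
  (exists X, [/\ X \in affine_covectors, Z \subset zeros X & face_le k X]) ->
  \sum_(X in affine_covectors | (Z \subset zeros X) && face_le k X)
    codim_sign (zeros X) = codim_sign Z.
Proof.
have [m] := ubnP #|zeros k :\: Z|%SET; elim: m => // m IHm in Z k *.
rewrite ltnS => le_m [X [LX ZX kX]].
have [/existsP[Y /existsP[g /and4P[LY ZY kY neq]]]|/existsPn noY] :=
  boolP [exists Y, exists g, [&& Y \in affine_covectors, Z \subset zeros Y,
     face_le k Y & X g != Y g]]; last first.
  rewrite (big_pred1 X) => [|Y /=].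
    rewrite /codim_sign (normal_span_zeros LX ZX) // => Y LY ZY XY.
    apply/ffunP => g; apply/eqP; have /existsPn/(_ g) := noY Y.
    by rewrite LY ZY (face_le_trans kX XY) /= negbK eq_sym.
  apply/and3P/eqP => [[LY ZY kY]|-> //]; apply/ffunP => g; apply/eqP.
  by have /existsPn/(_ g) := noY Y; rewrite LY ZY kY /= negbK eq_sym.
(* Below, g takes different signs on the faces X and Y of the region. *)
have kg : k g = None.
  apply/eqP; apply: contraNT neq => /eqP kg.
  by rewrite -(elimT (face_leP _ _) kX _ kg) -(elimT (face_leP _ _) kY _ kg).
have gZ : g \notin Z.
  apply: contraNN neq => gZ; have /zerosP-> := fintype.subsetP ZX g gZ.
  by have /zerosP-> := fintype.subsetP ZY g gZ.
have reflW X1 X2 : X1 \in affine_covectors -> Z \subset zeros X1 -> face_le k X1 ->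
    X2 \in affine_covectors -> Z \subset zeros X2 ->
    [/\ reflect_in X1 X2 \in affine_covectors, Z \subset zeros (reflect_in X1 X2) &
      face_le k (reflect_in X1 X2)].
  move=> LX1 ZX1 kX1 LX2 ZX2; split; first exact: affine_reflect.
    apply/fintype.subsetP => e eZ; apply/zerosP; rewrite ffunE.
    have /zerosP-> := fintype.subsetP ZX1 e eZ.
    by have /zerosP-> := fintype.subsetP ZX2 e eZ.
  exact/(face_le_trans kX1)/reflect_in_face.
have sides b : exists X', [/\ X' \in affine_covectors, Z \subset zeros X',
    face_le k X' & X' g = Some b].
  have [Y' [LY' ZY' kY' neq']] : exists Y', [/\ Y' \in affine_covectors,
      Z \subset zeros Y', face_le k Y' & Y' g = Some b \/ Y' g = Some (~~ b) /\
      exists X', [/\ X' \in affine_covectors, Z \subset zeros X',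
         face_le k X' & X' g <> Some (~~ b)]].
    case Xg : (X g) => [b'|].
      have [<-|bb'] := eqVneq b' b; first by exists X; split=> //; left.
      exists X; split=> //; right; split; first by rewrite Xg; case: b b' bb' {Xg} => [] [].
      exists Y; split=> // Yg; case/eqP: neq; rewrite Xg Yg.
      by case: b b' bb' {Xg Yg} => [] [].
    case Yg : (Y g) => [b'|]; last by rewrite Xg Yg eqxx in neq.
    have [bb'|bb'] := eqVneq b' b; first by exists Y; split=> //; left; rewrite Yg bb'.
    exists Y; split=> //; right; split; first by rewrite Yg; case: b b' bb' {Yg} => [] [].
    by exists X; split=> //; rewrite Xg.
  case: neq' => [Y'g|[Y'g [X' [LX' ZX' kX' X'g]]]]; first by exists Y'.
  case X'b : (X' g) => [b'|].
    exists X'; split=> //; rewrite X'b; move: X'g; rewrite X'b.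
    by case: b {Y'g} b' {X'b} => [] [].
  have [LW ZW kW] := reflW X' Y' LX' ZX' kX' LY' ZY'.
  by exists (reflect_in X' Y'); split=> //; rewrite ffunE X'b Y'g /= negbK.
have kcE b X' : face_le (constrain k g (Some b)) X' = face_le k X' && (X' g == Some b).
  by apply: face_le_constrain => //; left.
have zk : zeros k :\: Z = (g |: (zeros k :\: (g |: Z)))%SET.
  by apply/finset.setP => e; rewrite !inE; have [->|] := eqVneq e g; rewrite ?gZ ?kg.
have half b : \sum_(X in affine_covectors |
      [&& Z \subset zeros X, face_le k X & X g == Some b]) codim_sign (zeros X)
    = codim_sign Z.
  rewrite -(IHm Z (constrain k g (Some b))).
  - by apply: eq_bigl => X'; rewrite kcE.
  - apply: leq_trans le_m; rewrite (zeros_constrain b kg) finset.setDUl.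
    rewrite (_ : ([set g] :\: Z = [set g])%SET) ?cardsU1 ?inE ?ffunE ?eqxx ?andbF //.
    by apply/finset.setP => e; rewrite !inE andbC; have [->|] := eqVneq e g.
  have [X' [LX' ZX' kX' X'g]] := sides b.
  by exists X'; rewrite kcE kX' X'g eqxx.
have mid : \sum_(X in affine_covectors |
      [&& Z \subset zeros X, face_le k X & X g == None]) codim_sign (zeros X)
    = - codim_sign Z.
  transitivity (codim_sign (g |: Z)%SET); last first.
    by rewrite /codim_sign (normal_span_vary LX LY) // exprS mulN1r.
  rewrite -(IHm (g |: Z)%SET k).
  - apply: eq_bigl => X'; rewrite finset.subUset finset.sub1set [g \in _]inE.
    by case: (X' g == None); rewrite ?andbT ?andbF.
  - by apply: leq_trans le_m; rewrite zk cardsU1 !inE eqxx.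
  have [X1 [LX1 ZX1 kX1 X1g]] := sides true.
  have [X2 [LX2 ZX2 kX2 X2g]] := sides false.
  have [X' [LX' X'g X'E]] := affine_elim LX1 LX2 X1g X2g.
  exists X'; split=> //.
    rewrite finset.subUset finset.sub1set inE X'g eqxx /=.
    apply/fintype.subsetP => e eZ; apply/zerosP.
    have /zerosP X1e := fintype.subsetP ZX1 e eZ.
    have /zerosP X2e := fintype.subsetP ZX2 e eZ.
    by rewrite X'E ?X1e.
  apply/face_leP => e ke.
  by rewrite X'E -(elimT (face_leP _ _) kX1 _ ke) // -(elimT (face_leP _ _) kX2 _ ke).
rewrite (bigID [pred X' : covector | X' g == None]) /=.
rewrite [X in _ + X](bigID [pred X' : covector | X' g == Some true]) /=.
rewrite -[RHS]add0r -[in RHS](addNr (codim_sign Z)) -addrA; congr (_ + (_ + _)).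
- by rewrite -mid; apply: eq_bigl => X'; rewrite -!andbA.
- rewrite -(half true); apply: eq_bigl => X'.
  by case: (X' g) => [[]|]; rewrite ?andbT ?andbF.
- rewrite -(half false); apply: eq_bigl => X'.
  by case: (X' g) => [[]|]; rewrite ?andbT ?andbF.
Qed.

Lemma affine_euler_covectors : euler_covectors affine_covectors codim_sign.
Proof.
split.
- exact: affine_reflect.
- exact: affine_elim.
- by move=> Z; rewrite /codim_sign -signr_odd mulr_sign; case: odd; rewrite ?opprK.
- move=> e; rewrite /codim_sign /normal_span finset.big_set1 mxrank_gen rank_rV.
  by rewrite a_neq0.
- exact: affine_euler_sum.
Qed.

End AffineCovectors.

(** * Closures of cells *)
Section Closures.
Local Open Scope classical_set_scope.
Variables (R : realType) (n : nat) (E : finType).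
Variables (a : E -> 'rV[R]_n) (c : E -> R).
Local Notation covector := {ffun E -> sign}.

Lemma dotp_continuous (b : 'rV[R]_n) : continuous (dotp b).
Proof.
apply: continuous_big => [|i _ x]; first exact: add_continuous.
apply: (@continuous_comp _ _ _ (fun y : 'rV[R]_n => y 0 i)).
  exact: coord_continuous.
exact: mulrl_continuous.
Qed.

Lemma near_sign (b : 'rV[R]_n) (r : R) x : sign_of (dotp b x - r) <> None ->
  \forall y \near x, sign_of (dotp b y - r) = sign_of (dotp b x - r).
Proof.
have [x0 _|x0 _|<-] := ltgtP 0 (dotp b x - r); last by rewrite sign_of0.
  rewrite (sign_of_pos x0).
  have nb : nbhs x (dotp b @^-1` [set u | r < u]).
    apply: (@dotp_continuous b x); apply: open_nbhs_nbhs; split; first exact: open_gt.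
    by rewrite /= -subr_gt0.
  by apply: filterS nb => y /= ry; apply: sign_of_pos; rewrite subr_gt0.
rewrite (sign_of_neg x0).
have nb : nbhs x (dotp b @^-1` [set u | u < r]).
  apply: (@dotp_continuous b x); apply: open_nbhs_nbhs; split; first exact: open_lt.
  by rewrite /= -subr_lt0.
by apply: filterS nb => y /= ry; apply: sign_of_neg; rewrite subr_lt0.
Qed.

(** The neighbourhood contains a ball for the supremum norm; the step t is taken
    below its radius divided by 1 plus the sum of the coordinates of d. *)
Lemma near_segment (x d : 'rV[R]_n) (B : set 'rV[R]_n) : nbhs x B ->
  exists2 t, 0 < t < 1 & B (x + t *: d).
Proof.
move=> /nbhs_ballP[e /= e0 eB].
pose s := \sum_i `|d 0 i|; have s0 : 0 <= s by apply: sumr_ge0.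
pose t := Num.min (2^-1) (e / (1 + s)).
have et : 0 < e / (1 + s) by rewrite divr_gt0 //; lra.
have t0 : 0 < t by rewrite /t lt_min et andbT; lra.
exists t; first by rewrite t0 /t gt_min; apply/orP; left; lra.
apply: eB; split=> // i j; rewrite ord1 !mxE /ball /= opprD addNKr normrN.
rewrite normrM gtr0_norm //.
have dj : `|d 0 j| <= s.
  by rewrite /s (bigD1 j) //= lerDl sumr_ge0.
have te : t <= e / (1 + s) by rewrite /t ge_min lexx orbT.
have : t * (1 + s) <= e by rewrite -ler_pdivlMr //; lra.
by nra.
Qed.

(** A nonzero sign is locally constant, so that a limit of points of the cell
    can only lose signs.  Conversely, all points of the segment from such an x
    to a point of the cell, except x, belong to the cell. *)
Lemma closure_cell X : X \in affine_covectors a c ->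
  closure [set x | covector_at a c x = X] =
  [set x | face_le (covector_at a c x) X].
Proof.
move=> /affine_covectorsP[y yX]; apply/seteqP; split=> x /=.
  move=> clx; apply/face_leP => e; rewrite ffunE => /near_sign/clx[z [/= zX zx]].
  by rewrite -zX ffunE.
move=> /face_leP xX B /(near_segment (y - x))[t /andP[t0 t1] Bt].
exists (x + t *: (y - x)); split=> //=; apply/ffunP => e.
rewrite -yX !ffunE level_move (dotp_level a c); have := xX e; rewrite -yX !ffunE.
case sx: (sign_of (level a c e x)) => [b|].
  by move=> sE; rewrite sign_of_convex ?sx -?sE.
by rewrite (sign_of_eq0 sx) add0r subr0 sign_of_scale.
Qed.

End Closures.

(** * Sets of points and their sign vectors *)
Section Translation.
Local Open Scope classical_set_scope.
Variables (R : realType) (n : nat).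
Variable hs : set 'rV[R]_n -> bool -> set 'rV[R]_n.
Variable A : {fset set 'rV[R]_n}.
Variables (a : A -> 'rV[R]_n) (c : A -> R).
Hypothesis hsP : forall e, [/\ a e != 0, val e = [set x | dotp (a e) x = c e],
  hs (val e) true = [set x | c e < dotp (a e) x] &
  hs (val e) false = [set x | dotp (a e) x < c e]].
Local Notation covector := {ffun A -> sign}.
Local Notation L := (affine_covectors a c).
Implicit Types (X Y C D : covector) (e : A).

Lemma regionP e s x : region hs (val e) s x <-> covector_at a c x e = s.
Proof.
have [_ H0 Ht Hf] := hsP e; rewrite ffunE /level.
have -> : region hs (val e) s x = (if s is Some b then
   if b then c e < dotp (a e) x : Prop else dotp (a e) x < c e : Prop
   else dotp (a e) x = c e).
  by case: s => [[]|] /=; rewrite ?Ht ?Hf // H0.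
rewrite -subr_gt0 -(subr_lt0 (c e)).
split; last first.
  case: s => [[]|]; last by move=> /sign_of_eq0/eqP; rewrite subr_eq0 => /eqP.
    by have [|/sign_of_neg->|<-] := ltgtP 0 (_ - c e); rewrite ?sign_of0.
  by have [/sign_of_pos->||<-] := ltgtP 0 (_ - c e); rewrite ?sign_of0.
case: s => [[/sign_of_pos//|/sign_of_neg//]|->].
by rewrite subrr sign_of0.
Qed.

Lemma cellE X : cell hs X = [set x | covector_at a c x = X].
Proof.
apply/seteqP; split=> x /= => [cX|<- e]; last exact/regionP.
by apply/ffunP => e; apply/regionP/cX.
Qed.

Lemma cell_nonempty X : cell hs X !=set0 <-> X \in L.
Proof.
rewrite cellE; split=> [[x /= xX]|/affine_covectorsP//].
by apply/affine_covectorsP; exists x.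
Qed.

Lemma cell_inj X Y : X \in L -> cell hs X = cell hs Y -> X = Y.
Proof.
move=> /cell_nonempty[x xX] XY; have := xX; rewrite XY; move: xX.
by rewrite !cellE /= => ->.
Qed.

Lemma facesP F : reflect (exists2 X, X \in L & F = cell hs X) (F \in faces hs A).
Proof.
apply: (iffP (imfsetP _ _ _ _)) => [[X /= /asboolP/cell_nonempty LX ->]|[X LX ->]].
  by exists X.
by exists X => //=; apply/asboolP/cell_nonempty.
Qed.

Lemma eps_eq e s F : F !=set0 -> F `<=` region hs (val e) s ->
  eps hs (val e) F = s.
Proof.
move=> [x Fx] Fs; rewrite /eps; case: pickP => [s' /asboolP Fs'|/(_ s)/asboolP//].
by have /regionP <- := Fs x Fx; have /regionP <- := Fs' x Fx.
Qed.

Lemma eps_cell X e : X \in L -> eps hs (val e) (cell hs X) = X e.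
Proof. by move=> /cell_nonempty cX; apply: eps_eq => // x; apply. Qed.

Lemma chambersP F : reflect (exists X, [/\ X \in L, tope X & F = cell hs X])
  (F \in chambers hs A).
Proof.
rewrite !inE /=; apply: (iffP andP) => [[/facesP[X LX ->] tX]|[X [LX tX ->]]].
  exists X; split=> //; apply/forallP => e.
  by have := forallP tX e; rewrite eps_cell.
split; first by apply/facesP; exists X.
by apply/forallP => e; rewrite eps_cell //; apply: (forallP tX).
Qed.

Lemma cell_face X e : X \in L ->
  (cell hs X `<=` val e) <-> (X e = None).
Proof.
move=> LX; split=> [sub|Xe x]; last first.
  by rewrite cellE /= => xX; apply/(regionP e None); rewrite xX.
by rewrite -(eps_cell e LX); apply: eps_eq => //; apply/cell_nonempty.
Qed.

(** The partial sign vector of an apartment is that of the chamber K of B,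
    extended by None outside B. *)
Lemma apartmentP K : is_apartment hs A K ->
  exists k : covector, K = [set x | face_le k (covector_at a c x)].
Proof.
case=> B BA; rewrite !inE /= => /andP[/imfsetP[X /= /asboolP neX KX] tK].
pose k : covector := [ffun e => if val e \in B then eps hs (val e) K else None].
exists k; have epsX (e : B) (eA : val e \in A) : eps hs (val e) K = X e.
  by rewrite (eps_eq (e := [` eA]%fset) (s := X e)) ?KX // => x cX; exact: (cX e).
rewrite {1}KX; apply/seteqP; split=> x /=.
  move=> cX; apply/face_leP => e; rewrite ffunE; case: ifP => // eB _.
  have eA : val [` eB]%fset \in A := valP e.
  rewrite -[val e]/(val [` eB]%fset) epsX //.
  by symmetry; apply/regionP; exact: (cX [` eB]%fset).
move=> /face_leP kx e; have eA : val e \in A by exact: (fsubsetP BA) (valP e).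
apply/(regionP [` eA]%fset); rewrite -kx ffunE /= (valP e) epsX //.
by rewrite -(epsX e eA); apply/eqP/(forallP tK).
Qed.

Definition cone k : set 'rV[R]_n := [set x | face_le k (covector_at a c x)].

Lemma cell_in_cone k X : X \in L -> (cell hs X `<=` cone k) <-> face_le k X.
Proof.
move=> LX; rewrite cellE; split=> [sub|kX x /= xX]; last by rewrite /cone /= xX.
by have [x xX] := elimT (affine_covectorsP _ _ _) LX; rewrite -xX; apply: sub.
Qed.

Lemma faces_inP k F :
  reflect (exists X, [/\ X \in L, face_le k X & F = cell hs X])
    (F \in faces_in hs A (cone k)).
Proof.
rewrite !inE /=; apply: (iffP andP) => [[/facesP[X LX ->] /asboolP]|[X [LX kX ->]]].
  by move=> /(cell_in_cone _ LX); exists X.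
by split; [apply/facesP; exists X | apply/asboolP/cell_in_cone].
Qed.

Lemma chambers_inP k F :
  reflect (exists X, [/\ X \in L, tope X, face_le k X & F = cell hs X])
    (F \in chambers_in hs A (cone k)).
Proof.
rewrite in_fsetI; apply: (iffP andP).
  move=> [/chambersP[X [LX tX ->]] /faces_inP[Y [LY kY]]].
  by move=> /(cell_inj LX) XY; exists X; split=> //; rewrite XY.
by move=> [X [LX tX kX ->]]; split; [apply/chambersP | apply/faces_inP]; exists X.
Qed.

Lemma big_cells (Rg : comNzRingType) (S : {fset set 'rV[R]_n}) (P : pred covector)
    (f : set 'rV[R]_n -> Rg) :
  (forall F, reflect (exists X, [/\ X \in L, P X & F = cell hs X]) (F \in S)) ->
  \prod_(F <- S) f F = \prod_(X in L | P X) f (cell hs X).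
Proof.
move=> SP; transitivity (\prod_(F <- [seq cell hs X | X <- enum L & P X]) f F).
  2: by rewrite big_map big_filter big_enum_cond.
have memE X : (X \in [seq X <- enum L | P X]) = P X && (X \in L).
  by rewrite mem_filter mem_enum.
apply: perm_big; apply: uniq_perm.
- exact: fset_uniq.
- rewrite map_inj_in_uniq => [|X Y]; first exact/filter_uniq/enum_uniq.
  by rewrite memE => /andP[_ LX] _; apply: cell_inj.
move=> F; apply/SP/mapP => [[X [LX PX ->]]|[X]].
  by exists X; rewrite // memE LX PX.
by rewrite memE => /andP[PX LX] ->; exists X.
Qed.

Lemma card_cells (S : {fset set 'rV[R]_n}) (P : pred covector) :
  (forall F, reflect (exists X, [/\ X \in L, P X & F = cell hs X]) (F \in S)) ->
  #|` S| = #|[set X in L | P X]%SET|.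
Proof.
move=> SP; rewrite cardE -(size_map (@cell R n hs A)); apply: perm_size.
apply: uniq_perm.
- exact: fset_uniq.
- rewrite map_inj_in_uniq ?enum_uniq // => X Y.
  by rewrite !mem_enum => /setIdP[LX _] _; apply: cell_inj.
move=> F; apply/SP/mapP => [[X [LX PX ->]]|[X]].
  by exists X => //; rewrite mem_enum; apply/setIdP.
by rewrite mem_enum => /setIdP[LX PX] ->; exists X.
Qed.

(** The topological condition defining the multiplicity says that the faces of
    the chamber lying in H are exactly the faces of X, that is, X is its
    hinge. *)
Lemma mult_cell X e : X \in L -> X e = None ->
  mult hs A (val e) (cell hs X) = multiplicity L e X.
Proof.
move=> LX Xe; congr (_ %/ 2)%N; apply: card_cells => C.
have ccell Y : Y \in L -> closure (cell hs Y) = [set x | face_le (covector_at a c x) Y].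
  by move=> LY; rewrite cellE closure_cell.
have valE x : val e x <-> covector_at a c x e = None by apply: (regionP e None).
rewrite inE /=; apply: (iffP andP).
  move=> [/chambersP[Y [LY tY ->]]] /asboolP; rewrite !ccell // => clE.
  have clP x : face_le (covector_at a c x) Y /\ covector_at a c x e = None <->
      face_le (covector_at a c x) X.
    by rewrite -valE; have := congr1 (fun S => S x) clE => /= <-.
  exists Y; split=> //; rewrite tY /=; apply/hingeP.
  have [x xX] := elimT (affine_covectorsP _ _ _) LX.
  have /clP[XY _] : face_le (covector_at a c x) X by rewrite xX face_le_refl.
  rewrite xX in XY; split=> // F /affine_covectorsP[y <-] yY ye.
  exact/clP.
move=> [Y [LY /andP[tY /hingeP[_ XY _ maxX]] ->]].
split; first by apply/chambersP; exists Y.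
apply/asboolP; rewrite !ccell //; apply/seteqP; split=> x /=.
  by move=> [xY /valE xe]; apply: maxX => //; apply: covector_at_in.
move=> xX; split; first exact: face_le_trans XY.
by apply/valE/zerosP/(fintype.subsetP (face_le_zeros xX))/zerosP.
Qed.

Lemma localization_cell X e : X \in L ->
  (val e \in localization A (cell hs X)) = (e \in zeros X).
Proof.
move=> LX; rewrite !inE /= (valP e) /=.
by apply/asboolP/eqP => /cell_face; apply.
Qed.

Lemma weight_cell X : X \in L -> weight A (cell hs X) = face_weight (@hvar R n A) X.
Proof. by move=> LX; apply: eq_bigl => e; apply: localization_cell. Qed.

Lemma v_cell X Y : X \in L -> Y \in L -> tope X -> tope Y ->
  v hs A (cell hs X) (cell hs Y) = dist (@hvar R n A) X Y.
Proof.
move=> LX LY tX tY; rewrite /v /dist; case: eqP => [/(cell_inj LX)->|_].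
  by rewrite big_pred0 // => e; rewrite eqxx.
transitivity (\prod_(e : A) \prod_(b : bool |
    (X e == sopp (Y e)) && (X e == Some b)) hvar e b).
  rewrite pair_big_dep /=; apply: eq_bigl => p.
  by rewrite inE !eps_cell.
rewrite [RHS]big_mkcond; apply: eq_bigr => e _.
have := elimT (topeP _) tX e; have := elimT (topeP _) tY e.
rewrite big_mkcond big_bool /=.
by case: (X e) (Y e) => [[]|] [[]|] //= _ _; rewrite ?mulr1 ?mul1r.
Qed.

End Translation.

(** * Powers of the weights *)
Section Weights.
Variables (R : realType) (n : nat) (A : {fset set 'rV[R]_n}).

(** At the point where every variable equals 2, the weight of a face on z
    hyperplanes takes the value 4 ^ z, and 1 - 4 ^ z has absolute value at
    least 3. *)
Lemma weight_powers_inj (X : {ffun A -> sign}) : ~~ tope X ->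
  injective (fun m => (1 - face_weight (@hvar R n A) X) ^+ m).
Proof.
move=> /forallPn[e0 /negPn Xe0] m1 m2 /=.
pose ev := meval (fun _ : 'I_#|{: A * bool}| => 2 : int).
have ev_w : ev (face_weight (@hvar R n A) X) = 4 ^+ #|zeros X|.
  rewrite /ev /face_weight rmorph_prod -prodr_const; apply: eq_bigr => e _.
  by rewrite rmorphM /= /hvar !mevalXU.
move=> /(congr1 ev); rewrite /ev !rmorphXn !rmorphB rmorph1 /= -/ev ev_w.
move=> /(congr1 Num.norm); rewrite !normrX.
have z_gt0 : (0 < #|zeros X|)%N by apply/card_gt0P; exists e0; rewrite inE.
have : 3 <= `|1 - 4 ^+ (#|zeros X|)| :> int.
  case: #|zeros X| z_gt0 => // z _; rewrite distrC exprS.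
  have : 1 <= 4 ^+ z :> int by apply: exprn_ege1.
  by move=> z1; rewrite ger0_norm; lia.
by move=> ge3; apply: ieexprIn; lia.
Qed.

End Weights.

(** * The determinant formula *)
Theorem theorem1p3 (R : realType) (n : nat)
    (hs : set 'rV[R]_n -> bool -> set 'rV[R]_n)
    (A : {fset set 'rV[R]_n}) (K : set 'rV[R]_n)
    (chosenH : set 'rV[R]_n -> set 'rV[R]_n) :
  is_labelling hs ->
  is_arrangement A ->
  is_apartment hs A K ->
  (forall F, F \in (faces hs A `\` chambers hs A)%fset ->
     chosenH F \in localization A F) ->
  \det (vmatrix hs A K) =
  \prod_(F <- (faces_in hs A K `\` chambers_in hs A K)%fset)
     (1 - weight A F) ^+ mult hs A (chosenH F) F.
Proof.
move=> hsL arrA apK chosenP.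
have [p pP] : exists p : A -> 'rV[R]_n * R, forall e, [/\ (p e).1 != 0,
    val e = [set x | dotp (p e).1 x = (p e).2]%classic,
    hs (val e) true = [set x | (p e).2 < dotp (p e).1 x]%classic &
    hs (val e) false = [set x | dotp (p e).1 x < (p e).2]%classic].
  suff /choice[p pP] : forall e : A, exists q : 'rV[R]_n * R, [/\ q.1 != 0,
    val e = [set x | dotp q.1 x = q.2]%classic,
    hs (val e) true = [set x | q.2 < dotp q.1 x]%classic &
    hs (val e) false = [set x | dotp q.1 x < q.2]%classic] by exists p.
  move=> e.
  by have [b [r H]] := hsL _ (arrA _ (valP e)); exists (b, r).
pose a e := (p e).1; pose c e := (p e).2.
have hsP e : [/\ a e != 0, val e = [set x | dotp (a e) x = c e]%classic,
  hs (val e) true = [set x | c e < dotp (a e) x]%classic &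
  hs (val e) false = [set x | dotp (a e) x < c e]%classic] by apply: pP.
have a_neq0 e : a e != 0 by have [] := hsP e.
have [k KE] := apartmentP hsP apK; rewrite -/(cone a c k) in KE.
rewrite {K apK}KE; set L := affine_covectors a c.
pose rho := codim_sign a (mpoly #|{: A * bool}| int : idomainType).
have eulerL : euler_covectors L rho by apply: affine_euler_covectors.
have nonchamberP F : reflect
    (exists X, [/\ X \in L, ~~ tope X && face_le k X & F = cell hs X])
    (F \in (faces_in hs A (cone a c k) `\` chambers_in hs A (cone a c k))%fset).
  rewrite in_fsetD; apply: (iffP andP).
    move=> [nC /(faces_inP hsP)[X [LX kX FE]]]; exists X; split=> //.
    rewrite kX andbT; apply: contra nC => tX.
    by apply/(chambers_inP hsP); exists X.
  move=> [X [LX /andP[tX kX] ->]]; split; last by apply/(faces_inP hsP); exists X.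
  apply: contra tX => /(chambers_inP hsP)[Y [LY tY _]].
  by move=> /(cell_inj hsP LX) ->.
rewrite (big_cells hsP _ nonchamberP).
set T := chambers_in hs A (cone a c k).
have ex_tp (i : 'I_#|{: T}|) : exists X, [/\ X \in L, tope X, face_le k X &
    val (enum_val i) = cell hs X].
  exact/(chambers_inP hsP)/valP.
have [tp tpE] := choice ex_tp.
have tp_inj : injective tp.
  move=> i j ij; apply: enum_val_inj; apply: val_inj.
  by have [_ _ _ ->] := tpE i; have [_ _ _ ->] := tpE j; rewrite ij.
have tpP X : (X \in codom tp) = [&& X \in L, tope X & face_le k X].
  apply/codomP/and3P => [[i ->]|[LX tX kX]]; first by have [] := tpE i.
  have TX : cell hs X \in T by apply/(chambers_inP hsP); exists X.
  exists (enum_rank [` TX]%fset); have [LY _ _] := tpE (enum_rank [` TX]%fset).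
  by rewrite enum_rankK => /(cell_inj hsP LX).
(* Rows and columns are exchanged, since the entry (C, D) is v(D, C). *)
have -> : vmatrix hs A (cone a c k) = (cone_mx (@hvar R n A) tp k)^T.
  apply/matrixP => i j; rewrite !mxE.
  have [LX tX kX ->] := tpE i; have [LY tY kY ->] := tpE j.
  by rewrite kX kY (v_cell hsP LY LX tY tX).
rewrite det_tr.
pose mu (X : {ffun A -> sign}) := mult hs A (chosenH (cell hs X)) (cell hs X).
transitivity (\prod_(X in L | ~~ tope X && face_le k X)
    (1 - face_weight (@hvar R n A) X) ^+ mu X); last first.
  by apply: eq_bigr => X /andP[LX _]; rewrite (weight_cell hsP LX).
apply: (det_cone_mx eulerL _ tp_inj tpP (face_le_refl k)) => [X _|X LX tX].
  exact: weight_powers_inj.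
have : chosenH (cell hs X) \in localization A (cell hs X).
  apply: chosenP; rewrite in_fsetD; apply/andP; split; last first.
    by apply/(facesP hsP); exists X.
  apply: contra tX => /(chambersP hsP)[Y [LY tY]].
  by move=> /(cell_inj hsP LX) ->.
move=> /[dup] chX; rewrite !inE => /andP[/= chA _].
have Xe : X [` chA]%fset = None.
  by apply/zerosP; rewrite -(localization_cell hsP).
by exists [` chA]%fset => //; rewrite -(mult_cell hsP LX Xe).
Qed.
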